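(* Suppose that $|\Sigma|=N_{\mathbb R}$. The following are equivalent for $h\in\mathrm{SF}(N,\Sigma,\Gamma)$ defining a Cartier divisor $D=D_h$ on $T^\Gamma_\Sigma$: (i) $D$ is very ample. (ii) $h$ is strictly upper convex, and for all $\sigma\in\Sigma(d)$ the set $\{m-m_\sigma\mid m\in P_D^\Gamma\}$ generates the semigroup $\Gamma_\sigma$.
   Context: $k$ is an algebraically closed field. $N$ is a lattice of rank $d$ with dual $M$; $\check\sigma$ is the dual of a cone $\sigma\subset N_{\mathbb R}$; $\tau\leq\sigma$ means $\tau$ is a face of $\sigma$. For a semigroup $\Lambda\subset M$ with $\mathbb R_{\geq0}\Lambda=\check\sigma$ and $\tau\leq\sigma$, $M(\tau,\Lambda)$ is the sublattice generated by $\Lambda\cap\tau^\perp$. A triple $(N,\Sigma,\Gamma)$ consists of $N$, a fan $\Sigma$ in $N_{\mathbb R}$ (finite, strictly convex rational cones) and a family $\Gamma=\{\Gamma_\sigma\subset\check\sigma\cap M\}_{\sigma\in\Sigma}$ of finitely generated semigroups with (i) $\mathbb Z\Gamma_\sigma=M$, $\mathbb R_{\geq0}\Gamma_\sigma=\check\sigma$; (ii) $\Gamma_\tau=\Gamma_\sigma+M(\tau,\Gamma_\sigma)$ for $\tau\leq\sigma\in\Sigma$. The toric variety $T^\Gamma_\Sigma$ is obtained by glueing the affine varieties $T^{\Gamma_\sigma}=\mathrm{Spec}\,k[t^{\Gamma_\sigma}]$ along $T^{\Gamma_{\sigma\cap\sigma'}}$. $\Sigma(d)$ is the set of $d$-dimensional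 cones of $\Sigma$ and $|\Sigma|=\bigcup_{\sigma\in\Sigma}\sigma$. $\mathrm{SF}(N,\Sigma,\Gamma)$ is the group of continuous functions $h:|\Sigma|\to\mathbb R$ for which there are $m_\sigma\in M$ ($\sigma\in\Sigma$) with $h(\nu)=\langle\nu,m_\sigma\rangle$ for $\nu\in\sigma$, and $m_\tau=m_\sigma\mod M(\tau,\Gamma_\tau)$ for $\tau\leq\sigma\in\Sigma$. The $T^M$-invariant Cartier divisor $D_h$ on $T^\Gamma_\Sigma$ is the one given by $\mathrm{div}(t^{-m_\sigma})$ on $T^{\Gamma_\sigma}$. Put $P_D^\Gamma=\bigcap_{\sigma\in\Sigma}(m_\sigma+\Gamma_\sigma)\subset M$; one has $H^0(T^\Gamma_\Sigma,\mathcal O(D))=\bigoplus_{m\in P_D^\Gamma}k\,t^m$. When $|\Sigma|=N_{\mathbb R}$, $h$ is upper convex if $h(\nu)+h(\nu')\leq h(\nu+\nu')$ for all $\nu,\nu'\in N_{\mathbb R}$; it is strictly upper convex if it is upper convex and, for every $\sigma\in\Sigma(d)$, $h(\nu)=\langle\nu,m_\sigma\rangle$ if and only if $\nu\in\sigma$. *)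

(* Defs.v *)
From HB Require Import structures.
From mathcomp Require Import all_boot all_order all_algebra.
From mathcomp Require mpoly.

Set Implicit Arguments.
Unset Strict Implicit.
Unset Printing Implicit Defensive.

(** Multivariate polynomials are used inside this module only: the notations of
    [mpoly] clash with those of the analysis library. *)
Module HomogeneousPoly.
Import GRing.Theory mpoly.
Local Open Scope ring_scope.

Definition homog_poly (k : fieldType) (n e : nat) (p : {mpoly k[n]}) : bool :=
  p \is e.-homog.

Definition eval_row (k : fieldType) (n : nat) (p : {mpoly k[n]})
    (v : 'rV[k]_n) : k := p.@[v ord0].

End HomogeneousPoly.

From mathcomp Require Import all_classical all_reals all_analysis.

Import Order.TTheory GRing.Theory Num.Theory.
Import numFieldNormedType.Exports.
Import HomogeneousPoly.
Local Open Scope classical_set_scope.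
Local Open Scope ring_scope.

(** * Semigroups and lattices in [M]

    A basis of the lattice is fixed: [N] and its dual [M] are ['rV[int]_d],
    [N_R] and [M_R] are ['rV[R]_d], and the pairing is the standard one. *)

Section Generation.
Variable M : zmodType.

Definition add_closed_set (S : set M) : Prop :=
  forall u v, S u -> S v -> S (u + v).

Definition subgroup_set (S : set M) : Prop :=
  [/\ S 0, add_closed_set S & forall u, S u -> S (- u)].

(** Only nonempty sums are allowed: [0] belongs to the generated semigroup only
    if it is a sum of one or more elements of [A].  For the semigroup of a
    full-dimensional cone, which has no nonzero unit, "[A] generates [Gamma]"
    therefore includes that [0] is an element of [A]. *)
Definition semigroup_gen (A : set M) : set M := smallest add_closed_set A.

Definition group_gen (A : set M) : set M := smallest subgroup_set A.

(** A semigroup with unit [0], generated together with [0] by finitely many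
    elements. *)
Definition fin_gen_semigroup (S : set M) : Prop :=
  exists A : set M, finite_set A /\ S = semigroup_gen (A `|` [set 0]).

Definition minkowski_sum (A B : set M) : set M :=
  [set u + v | u in A & v in B].

End Generation.

(** * Cones, fans and support functions *)

Section Fans.
Variables (R : realType) (d : nat).
Local Notation MZ := 'rV[int]_d.
Local Notation VR := 'rV[R]_d.
Local Notation cone := (set VR).

Definition toR (u : MZ) : VR := map_mx intr u.

Definition pairing (nu u : VR) : R := \sum_(i < d) nu ord0 i * u ord0 i.

Definition conic_hull (A : set VR) : cone :=
  [set v | exists n (a : 'I_n -> VR) (c : 'I_n -> R),
     (forall i, A (a i) /\ 0 <= c i) /\ v = \sum_(i < n) c i *: a i].

Definition rational_cone (sigma : cone) : Prop :=
  exists A : set MZ, finite_set A /\ sigma = conic_hull (toR @` A).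

Definition strictly_convex (sigma : cone) : Prop :=
  forall nu, sigma nu -> sigma (- nu) -> nu = 0.

Definition dual_cone (sigma : cone) : cone :=
  [set u | forall nu, sigma nu -> 0 <= pairing nu u].

Definition face (tau sigma : cone) : Prop :=
  exists2 u, dual_cone sigma u & tau = sigma `&` [set nu | pairing nu u = 0].

(** The linear span of [sigma] has dimension [r]. *)
Definition cone_dim (sigma : cone) (r : nat) : Prop :=
  exists U : {vspace VR},
    [/\ \dim U = r,
        forall nu, sigma nu -> nu \in U &
        forall V : {vspace VR},
          (forall nu, sigma nu -> nu \in V) -> (U <= V)%VS].

Definition fan (Sigma : set cone) : Prop :=
  [/\ finite_set Sigma,
      forall sigma, Sigma sigma -> rational_cone sigma /\ strictly_convex sigma,
      forall sigma tau, Sigma sigma -> face tau sigma -> Sigma tau &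
      forall sigma sigma', Sigma sigma -> Sigma sigma' ->
        face (sigma `&` sigma') sigma /\ face (sigma `&` sigma') sigma'].

Definition fan_support (Sigma : set cone) : set VR := \bigcup_(sigma in Sigma) sigma.

(** [M(tau, Lambda)] *)
Definition face_lattice (tau : cone) (Lambda : set MZ) : set MZ :=
  group_gen
    (Lambda `&` [set u | forall nu, tau nu -> pairing nu (toR u) = 0]).

(** The triple [(N, Sigma, Gamma)]; only the values of [Gamma] on [Sigma]
    matter. *)
Definition toric_triple (Sigma : set cone) (Gamma : cone -> set MZ) : Prop :=
  [/\ fan Sigma,
      forall sigma, Sigma sigma ->
        fin_gen_semigroup (Gamma sigma) /\
        Gamma sigma `<=` [set u | dual_cone sigma (toR u)],
      forall sigma, Sigma sigma ->
        group_gen (Gamma sigma) = setT /\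
        conic_hull (toR @` Gamma sigma) = dual_cone sigma &
      forall sigma tau, Sigma sigma -> face tau sigma ->
        Gamma tau = minkowski_sum (Gamma sigma) (face_lattice tau (Gamma sigma))].

(** [h] belongs to [SF(N, Sigma, Gamma)], with linear data [m_sigma]. *)
Definition support_function (Sigma : set cone) (Gamma : cone -> set MZ)
    (h : VR -> R) (m : cone -> MZ) : Prop :=
  [/\ {within fan_support Sigma, continuous h},
      forall sigma nu, Sigma sigma -> sigma nu ->
        h nu = pairing nu (toR (m sigma)) &
      forall sigma tau, Sigma sigma -> face tau sigma ->
        face_lattice tau (Gamma tau) (m tau - m sigma)].

Definition upper_convex (h : VR -> R) : Prop :=
  forall nu nu', h nu + h nu' <= h (nu + nu').

Definition strictly_upper_convex (Sigma : set cone) (h : VR -> R)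
    (m : cone -> MZ) : Prop :=
  upper_convex h /\
  forall sigma, Sigma sigma -> cone_dim sigma d ->
    forall nu, h nu = pairing nu (toR (m sigma)) <-> sigma nu.

(** [P_D^Gamma] *)
Definition section_exponents (Sigma : set cone) (Gamma : cone -> set MZ)
    (m : cone -> MZ) : set MZ :=
  [set u | forall sigma, Sigma sigma -> Gamma sigma (u - m sigma)].

End Fans.

(** * Varieties as spaces with functions

    Over an algebraically closed field a variety is determined by its set of
    closed points, its Zariski topology, and the [k]-valued regular functions
    on its open sets; these are the data recorded here.  The points are a
    subset of an ambient type [T]; open sets are subsets of [points], and
    whether [f : T -> k] is regular on [U] only depends on the values of [f]
    on [U]. *)

Record space_with_functions (k : Type) (T : Type) := SpaceWithFunctions {
  points : set T;
  opens : set (set T);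
  regular_on : set T -> set (T -> k) }.

Definition pullback_set (k T T' : Type) (X : space_with_functions k T)
    (phi : T -> T') (V : set T') : set T := points X `&` phi @^-1` V.

Definition is_morphism (k T T' : Type) (X : space_with_functions k T)
    (Y : space_with_functions k T') (phi : T -> T') : Prop :=
  [/\ forall x, points X x -> points Y (phi x),
      forall V, opens Y V -> opens X (pullback_set X phi V) &
      forall V psi, opens Y V -> regular_on Y V psi ->
        regular_on X (pullback_set X phi V) (psi \o phi)].

(** [phi] is a homeomorphism onto a closed subset of [Y], and
    [O_Y -> phi_* O_X] is surjective (i.e. on germs). *)
Definition closed_immersion (k T T' : Type) (X : space_with_functions k T)
    (Y : space_with_functions k T') (phi : T -> T') : Prop :=
  [/\ is_morphism X Y phi,
      forall x y, points X x -> points X y -> phi x = phi y -> x = y,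
      opens Y (points Y `\` phi @` points X),
      forall U, opens X U -> exists2 V, opens Y V & U = pullback_set X phi V &
      forall U f x, opens X U -> regular_on X U f -> U x ->
        exists V psi, [/\ opens Y V, regular_on Y V psi, V (phi x) &
          forall y, U y -> V (phi y) -> f y = psi (phi y)]].

Section Glueing.
Variables (k I T : Type) (J : set I) (X : I -> space_with_functions k T).
Variable E : I * T -> I * T -> Prop.

Definition glue_class (i : I) (x : T) : set (I * T) :=
  [set p | [/\ J p.1, points (X p.1) p.2 & E (i, x) p]].

(** The quotient of the disjoint union of the [X i], [J i], by the equivalence
    relation [E]; its points are the equivalence classes. *)
Definition glue : space_with_functions k (set (I * T)) :=
  let chart i (U : set (set (I * T))) := pullback_set (X i) (glue_class i) U in
  let pts := [set c | exists i x,
                [/\ J i, points (X i) x & c = glue_class i x]] in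
  SpaceWithFunctions pts
    [set U | U `<=` pts /\ forall i, J i -> opens (X i) (chart i U)]
    (fun U => [set f : set (I * T) -> k |
       forall i, J i -> regular_on (X i) (chart i U) (f \o glue_class i)]).

End Glueing.

(** The points of [P^n] are the lines in [k^(n+1)]; the topology and the regular
    functions are given by homogeneous polynomials. *)
Definition projective_space (k : fieldType) (n : nat) :
    space_with_functions k {vspace 'rV[k]_n.+1} :=
  SpaceWithFunctions
    [set L | \dim L = 1%N]
    [set U | U `<=` [set L | \dim L = 1%N] /\
       forall v, v != 0 -> U <[v]>%VS ->
         exists e p, [/\ homog_poly e p, eval_row p v != 0 &
           forall w, w != 0 -> eval_row p w != 0 -> U <[w]>%VS]]
    (fun U => [set f : {vspace 'rV[k]_n.+1} -> k |
       forall v, v != 0 -> U <[v]>%VS ->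
         exists e p q, [/\ homog_poly e p, homog_poly e q, eval_row q v != 0 &
           forall w, w != 0 -> U <[w]>%VS -> eval_row q w != 0 ->
             f <[w]>%VS = eval_row p w / eval_row q w]]).

(** * Toric varieties *)

Section AffineToric.
Variables (k : fieldType) (M : zmodType) (Lambda : set M).

(** A closed point of [Spec k[t^Lambda]] is a [k]-algebra morphism
    [k[t^Lambda] -> k], i.e. a morphism of monoids from [Lambda] to the
    multiplicative monoid of [k]; it is represented by its extension [x] by [0]
    to [M].  The value of the monomial [t^u] at [x] is [x u]. *)
Definition toric_points : set (M -> k) :=
  [set x | [/\ x 0 = 1,
      forall u v, Lambda u -> Lambda v -> x (u + v) = x u * x v &
      forall u, ~ Lambda u -> x u = 0]].

(** The elements of [k[t^Lambda]], as functions. *)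
Definition toric_polys : set ((M -> k) -> k) :=
  [set f | exists r (c : 'I_r -> k) (u : 'I_r -> M),
     (forall i, Lambda (u i)) /\ f = (fun x => \sum_(i < r) c i * x (u i))].

Definition affine_toric : space_with_functions k (M -> k) :=
  SpaceWithFunctions
    toric_points
    [set U | U `<=` toric_points /\
       forall x, U x -> exists2 f, toric_polys f &
         f x != 0 /\ forall y, toric_points y -> f y != 0 -> U y]
    (fun U => [set phi |
       forall x, U x -> exists f g, [/\ toric_polys f, toric_polys g, g x != 0 &
         forall y, U y -> g y != 0 -> phi y = f y / g y]]).

(** The map [T^Lambda' -> T^Lambda] induced by an inclusion
    [Lambda `<=` Lambda']. *)
Definition restrict_point (x : M -> k) : M -> k :=
  fun u => if u \in Lambda then x u else 0.

End AffineToric.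

Section ToricVariety.
Variables (R : realType) (k : fieldType) (d : nat).
Local Notation MZ := 'rV[int]_d.
Local Notation cone := (set 'rV[R]_d).
Variables (Sigma : set cone) (Gamma : cone -> set MZ).

Definition toric_glue (p q : cone * (MZ -> k)) : Prop :=
  exists2 y, toric_points (Gamma (p.1 `&` q.1)) y &
    p.2 = restrict_point (Gamma p.1) y /\ q.2 = restrict_point (Gamma q.1) y.

(** [T^Gamma_Sigma] *)
Definition toric_variety :
    space_with_functions k (set (cone * (MZ -> k))) :=
  glue Sigma (fun sigma => affine_toric k (Gamma sigma)) toric_glue.

Definition toric_chart (sigma : cone) (x : MZ -> k) :
    set (cone * (MZ -> k)) :=
  glue_class Sigma (fun sigma => affine_toric k (Gamma sigma))
    toric_glue sigma x.

Variable m : cone -> MZ.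

(** Global sections of [O(D)] for the Cartier divisor [D] with local equation
    [t^(- m_sigma)] on [T^(Gamma_sigma)].  A rational function [f] is a global
    section of [O(D)] if and only if each [s sigma := f * t^(- m_sigma)] is
    regular on [T^(Gamma_sigma)]; the section is represented by the family [s],
    whose members are related on [T^Gamma_(sigma `&` sigma')] by the transition
    functions [t^(- m_sigma) / t^(- m_sigma')]. *)
Definition global_section (s : cone -> (MZ -> k) -> k) : Prop :=
  (forall sigma, Sigma sigma ->
     regular_on (affine_toric k (Gamma sigma))
       (toric_points (Gamma sigma)) (s sigma)) /\
  (forall sigma sigma' y, Sigma sigma -> Sigma sigma' ->
     toric_points (Gamma (sigma `&` sigma')) y ->
     s sigma (restrict_point (Gamma sigma) y) =
       y (m sigma' - m sigma) * s sigma' (restrict_point (Gamma sigma') y)).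

Definition same_section (s s' : cone -> (MZ -> k) -> k) : Prop :=
  forall sigma x, Sigma sigma -> toric_points (Gamma sigma) x ->
    s sigma x = s' sigma x.

Definition lin_comb_section n (c : 'I_n -> k)
    (s : 'I_n -> cone -> (MZ -> k) -> k) : cone -> (MZ -> k) -> k :=
  fun sigma x => \sum_(j < n) c j * s j sigma x.

(** [s] is a basis of the [k]-vector space [H^0(T^Gamma_Sigma, O(D))]. *)
Definition basis_of_sections n (s : 'I_n -> cone -> (MZ -> k) -> k) : Prop :=
  [/\ forall j, global_section (s j),
      forall c, same_section (lin_comb_section c s) (fun _ _ => 0) ->
        forall j, c j = 0 &
      forall s', global_section s' ->
        exists c, same_section s' (lin_comb_section c s)].

(** [D] has no base points and the morphism [phi] to projective space defined
    by its complete linear system is a closed immersion. *)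
Definition very_ample : Prop :=
  exists n (s : 'I_n.+1 -> cone -> (MZ -> k) -> k)
    (phi : set (cone * (MZ -> k)) -> {vspace 'rV[k]_n.+1}),
    [/\ basis_of_sections s,
        forall sigma x, Sigma sigma -> toric_points (Gamma sigma) x ->
          exists j, s j sigma x != 0,
        forall sigma x, Sigma sigma -> toric_points (Gamma sigma) x ->
          phi (toric_chart sigma x) = <[\row_j s j sigma x]>%VS &
        closed_immersion toric_variety (projective_space k n) phi].

End ToricVariety.

(* Main.v *)
(* Everything is decided by monomials.  A regular function on the torus is a Laurent
   polynomial: it is one along every coordinate line, with degrees bounded by those of
   a fixed local expression, so it can be interpolated one coordinate at a time.  On the
   chart of a full-dimensional cone [sigma], comparing lowest terms at the fixed point of
   the torus action shows that its exponents lie in [Gamma sigma]; hence the sections of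
   [O(D)] are the combinations of the [t^u] with [u] in [P_D].

   If [D] is very ample, a section does not vanish at the fixed point of the chart of
   [sigma], so [m sigma] is in [P_D].  For [v] in [Gamma sigma], the germ of [t^v] at that
   point is a quotient of elements of the semigroup algebra of [P_D - m sigma], and
   comparing the coefficients of [t^v] puts [v] in this semigroup.  Strict convexity then
   follows by biduality of cones.

   Conversely, strict convexity identifies the chart of [sigma] with the locus where the
   coordinate [t^(m sigma)] does not vanish, and generation makes the map a closed
   embedding of this chart.  The image is cut out by binomials: a vector satisfying them
   has a nonzero vertex coordinate, because by Farkas' lemma every [u] in [P_D] is a
   rational convex combination of the [m sigma]. *)
Require Import Defs.
From HB Require Import structures.
From mathcomp Require Import all_boot all_order all_algebra.
From mathcomp Require mpoly.

Set Implicit Arguments.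
Unset Strict Implicit.
Unset Printing Implicit Defensive.

Module HomogeneousSums.
Import GRing.Theory mpoly HomogeneousPoly.
Local Open Scope ring_scope.

Lemma homog_polyE (k : fieldType) (n e : nat) (p : {mpoly k[n]}) :
  homog_poly e p ->
  exists r (c : 'I_r -> k) (a : 'I_r -> 'I_n -> nat),
    (forall i, (\sum_j a i j = e)%N) /\
    forall v, eval_row p v = \sum_(i < r) c i * \prod_j v ord0 j ^+ a i j.
Proof.
move=> hp; pose mm i : 'X_{1..n} := nth 0%MM (msupp p) i.
exists (size (msupp p)), (fun i => p@_(mm i)), (fun i j => mm i j); split=> [i|v].
  rewrite -mdegE; apply: (dhomog_mf hp).
  exact: mem_nth.
rewrite /eval_row mevalE (big_nth 0%MM) big_mkord.
by [].
Qed.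

Lemma homog_poly_sum (k : fieldType) (n e r : nat) (c : 'I_r -> k)
    (a : 'I_r -> 'I_n -> nat) : (forall i, (\sum_j a i j = e)%N) ->
  exists p : {mpoly k[n]}, homog_poly e p /\
    forall v, eval_row p v = \sum_(i < r) c i * \prod_j v ord0 j ^+ a i j.
Proof.
move=> ha; exists (\sum_(i < r) c i *: 'X_[[multinom a i j | j < n]]); split.
  apply: rpred_sum => i _; apply: rpredZ.
  rewrite /homog_poly dhomogX /= mdegE; apply/eqP; rewrite -(ha i).
  by apply: eq_bigr => j _; rewrite mnmE.
move=> v; rewrite /eval_row raddf_sum /=; apply: eq_bigr => i _.
rewrite mevalZ mevalX; congr (_ * _).
by apply: eq_bigr => j _; rewrite mnmE.
Qed.

End HomogeneousSums.

From mathcomp Require Import all_classical all_reals all_analysis.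
From mathcomp Require Import ring lra zify.

Import Order.TTheory GRing.Theory Num.Theory.
Import numFieldNormedType.Exports.
Import HomogeneousPoly HomogeneousSums.
Local Open Scope classical_set_scope.
Local Open Scope ring_scope.

(** * Farkas' lemma over the reals and over the integers *)

Section DotProduct.
Variables (F : comNzRingType) (d : nat).
Implicit Types x y z : 'rV[F]_d.

Definition dot x y : F := \sum_(i < d) x ord0 i * y ord0 i.

Lemma dotC x y : dot x y = dot y x.
Proof. by apply: eq_bigr => i _; rewrite mulrC. Qed.

Lemma dot_is_linear x : scalar (dot x).
Proof.
move=> a y z; rewrite /dot mulr_sumr -big_split; apply: eq_bigr => i _ /=.
by rewrite !mxE mulrDr /= mulrCA.
Qed.
HB.instance Definition _ x :=
  GRing.isLinear.Build F 'rV[F]_d F *%R (dot x) (dot_is_linear x).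

Lemma dotDl x y z : dot (x + y) z = dot x z + dot y z.
Proof. by rewrite -!(dotC z) linearD. Qed.

Lemma dotZl a x y : dot (a *: x) y = a * dot x y.
Proof. by rewrite -!(dotC y) linearZ. Qed.

Lemma dot_delta x i : dot x (delta_mx ord0 i) = x ord0 i.
Proof.
rewrite /dot (bigD1 i) //= big1 ?addr0 ?mxE ?eqxx ?mulr1// => j /negPf ji.
by rewrite mxE ji andbF mulr0.
Qed.

Lemma dot_eq0 y : (forall x, dot x y = 0) -> y = 0.
Proof. by move=> h; apply/rowP => i; rewrite -dot_delta dotC h mxE. Qed.

Lemma linear_functionalE (f : {scalar 'rV[F]_d}) x :
  f x = dot x (\row_i f (delta_mx ord0 i)).
Proof.
rewrite {1}(row_sum_delta x) linear_sum; apply: eq_bigr => i _.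
by rewrite linearZ mxE.
Qed.

End DotProduct.

Lemma dot_map (F F' : comNzRingType) (f : {rmorphism F -> F'}) d
    (x y : 'rV[F]_d) : dot (map_mx f x) (map_mx f y) = f (dot x y).
Proof.
by rewrite rmorph_sum; apply: eq_bigr => i _; rewrite !mxE rmorphM.
Qed.

Lemma nat_nonroot (F : numDomainType) (p : {poly F}) : p != 0 ->
  exists B : nat, p.[B%:R] != 0.
Proof.
move=> p0; apply/not_existsP => h.
pose rs := [seq i%:R : F | i <- iota 0 (size p)].
have : (size rs < size p)%N.
  apply: max_poly_roots => //.
    by apply/allP => _ /mapP [i _ ->]; apply/eqP/eqP/negPn/negP/h.
  by rewrite map_inj_uniq ?iota_uniq// => i j /eqP; rewrite eqr_nat => /eqP.
by rewrite size_map size_iota ltnn.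
Qed.

Lemma avoid_hyperplanes (F : numDomainType) d (s : seq 'rV[F]_d) :
  exists w, forall u, u \in s -> u != 0 -> dot w u != 0.
Proof.
pose p (u : 'rV[F]_d) : {poly F} := \sum_(i < d) u ord0 i *: 'X^i.
have p_neq0 u : u != 0 -> p u != 0.
  apply: contraNneq => pu0; apply/eqP/rowP => i; rewrite mxE.
  have := congr1 (fun q : {poly F} => q`_i) pu0.
  rewrite coef0 coef_sum (bigD1 i) //= coefZ coefXn eqxx mulr1 big1 ?addr0//.
  by move=> j ji; rewrite coefZ coefXn eq_sym (negPf (ji : j != i :> nat)) mulr0.
have /nat_nonroot[B] : \prod_(u <- s | u != 0) p u != 0.
  by rewrite prodf_seq_neq0; apply/allP => u _; apply/implyP/p_neq0.
rewrite horner_prod prodf_seq_neq0 => /allP hB.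
exists (\row_i B%:R ^+ i) => u us u0; move/implyP: (hB u us) => /(_ u0).
rewrite horner_sum; congr (_ != _).
by apply: eq_bigr => i _; rewrite hornerZ hornerXn mxE mulrC.
Qed.

(* Bartl's induction: if some [x] is nonnegative on all the [a i] but the first,
   and negative on [b], then it is negative on the first one, and one can
   project along it. *)
Lemma farkas (F : realFieldType) d n (a : 'I_n -> 'rV[F]_d) (b : 'rV[F]_d) :
  (forall y, (forall i, 0 <= dot y (a i)) -> 0 <= dot y b) ->
  exists c : 'I_n -> F, (forall i, 0 <= c i) /\ b = \sum_i c i *: a i.
Proof.
elim: n a b => [|n IHn] a b hb.
  exists (fun=> 0); split=> //; rewrite big_ord0; apply: dot_eq0 => y.
  apply/eqP; rewrite eq_le hb ?andbT; last by case.
  by have := hb (- y) _; rewrite -scaleN1r dotZl mulN1r oppr_ge0; apply; case.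
have [h|] := pselect (forall y,
    (forall i : 'I_n, 0 <= dot y (a (lift ord0 i))) -> 0 <= dot y b).
  have [c [c0 bE]] := IHn _ _ h.
  exists (fun i => if unlift ord0 i is Some j then c j else 0); split=> [i|].
    by case: unliftP.
  rewrite big_ord_recl unlift_none scale0r add0r bE.
  by apply: eq_bigr => i _; rewrite liftK.
move=> /existsNP[x /not_implyP[xa /negP]]; rewrite -ltNge => xb.
have t0 : dot x (a ord0) < 0.
  rewrite ltNge; apply/negP => xa0; have : 0 <= dot x b.
    by apply: hb => i; case: (unliftP ord0 i) => [j ->|->].
  by rewrite leNgt xb.
set al := a ord0 in t0; set t := dot x al in t0.
pose proj u := u - (dot x u / t) *: al.
have [y hy|c [c0 bE]] := IHn (fun i => proj (a (lift ord0 i))) (proj b).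
  pose y' := y - (dot y al / t) *: x.
  have y'E u : dot y' u = dot y (proj u).
    by rewrite linearB linearZ /= /y' dotDl -scaleNr dotZl; lra.
  rewrite -y'E; apply: hb => i; case: (unliftP ord0 i) => [j ->|->].
    by rewrite y'E.
  rewrite y'E linearB linearZ /= -/al -/t divff ?lt_eqF// mul1r subrr//.
exists (fun i => if unlift ord0 i is Some j then c j
   else dot x b / t - \sum_j c j * (dot x (a (lift ord0 j)) / t)); split.
  move=> i; case: unliftP => // _; rewrite subr_ge0 (@le_trans _ _ 0)//.
    apply: sumr_le0 => j _; rewrite mulr_ge0_le0 ?mulr_ge0_le0 ?invr_le0//.
    exact: ltW.
  by rewrite mulr_le0 ?invr_le0 ?ltW.
rewrite big_ord_recl unlift_none -/al.
rewrite [X in _ + X](eq_bigr (fun i => c i *: a (lift ord0 i))); last first.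
  by move=> i _; rewrite liftK.
move/eqP: bE; rewrite subr_eq => /eqP {1}->.
rewrite (eq_bigr (fun i => c i *: a (lift ord0 i) -
  (c i * (dot x (a (lift ord0 i)) / t)) *: al)); last first.
  by move=> i _; rewrite scalerBr scalerA.
by rewrite sumrB -scaler_suml scalerBl [RHS]addrC [RHS]addrA [LHS]addrAC.
Qed.

Lemma common_denominator n (q : 'I_n -> rat) :
  exists2 N : nat, (0 < N)%N & forall i, exists z : int, q i * N%:R = z%:~R.
Proof.
exists (\prod_i `|denq (q i)|)%N.
  by apply: prodn_gt0 => i; rewrite absz_gt0 denq_neq0.
move=> i; rewrite (bigD1 i) //= natrM mulrA.
exists (numq (q i) * (\prod_(j | j != i) `|denq (q j)|)%N%:Z).
rewrite rmorphM /= numqE; congr (_ * _ * _).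
by rewrite pmulrn abszE gtr0_norm ?denq_gt0.
Qed.

Lemma int_farkas d n (g : 'I_n -> 'rV[int]_d) (u : 'rV[int]_d) :
  (forall y, (forall i, 0 <= dot y (g i)) -> 0 <= dot y u) ->
  exists (N : nat) (c : 'I_n -> nat),
    (0 < N)%N /\ u *+ N = \sum_i g i *+ c i.
Proof.
move=> hu; pose toQ := map_mx (intr : int -> rat) : 'rV[int]_d -> 'rV[rat]_d.
have [y hy|c [c0 uE]] := @farkas _ d n (toQ \o g) (toQ u).
  have [N N0 hN] := common_denominator (y ord0).
  have /choice[z hz] := hN.
  have NQ0 : 0 < N%:R :> rat by rewrite ltr0n.
  have zE : N%:R *: y = toQ (\row_i z i).
    by apply/rowP => i; rewrite !mxE -hz mulrC.
  have dE v : N%:R * dot y (toQ v) = (dot (\row_i z i) v)%:~R.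
    by rewrite -dotZl zE dot_map.
  rewrite -(pmulr_rge0 _ NQ0) dE ler0z; apply: hu => i.
  by rewrite -(ler0z rat) -dE pmulr_rge0//; exact: hy.
have [N N0 hN] := common_denominator c.
have /choice[z hz] := hN.
exists N, (fun i => `|z i|%N); split=> //.
have zE i : c i * N%:R = (`|z i|%N)%:R.
  have : 0 <= c i * N%:R by rewrite mulr_ge0.
  by rewrite hz ler0z => zi0; rewrite pmulrn abszE ger0_norm.
have inj : injective toQ.
  by move=> v w /rowP vw; apply/rowP => i; have := vw i; rewrite !mxE => /intr_inj.
apply: inj; rewrite /toQ [LHS]raddfMn [RHS]raddf_sum /= -/(toQ u) uE -sumrMnl.
apply: eq_bigr => i _.
by rewrite raddfMn /= -!scaler_nat scalerA mulrC zE.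
Qed.

(** * Functions on affine toric varieties *)

Section ToricFunctions.
Variables (k : fieldType) (M : zmodType) (Lambda : set M).

(* [toric_polys] is not closed under products, which are again sums of monomials
   only on [toric_points]. *)
Definition toric_fun (f : (M -> k) -> k) : Prop :=
  exists S : seq (k * M), (forall p, p \in S -> Lambda p.2) /\
    forall x, toric_points Lambda x -> f x = \sum_(p <- S) p.1 * x p.2.

Lemma toric_polys_fun f : toric_polys Lambda f -> toric_fun f.
Proof.
move=> [r [c [u [hu ->]]]]; exists [seq (c i, u i) | i <- enum 'I_r].
split=> [p /mapP[i _ ->]|x _]; first exact: hu.
by rewrite big_map big_enum.
Qed.

Lemma toric_fun_polys f : toric_fun f -> exists2 g, toric_polys Lambda g &
  forall x, toric_points Lambda x -> f x = g x.
Proof.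
move=> [S [hS hf]]; exists (fun x => \sum_(p <- S) p.1 * x p.2) => //.
exists (size S), (fun i => (nth (0, 0) S i).1), (fun i => (nth (0, 0) S i).2).
split=> [i|]; first exact/hS/mem_nth.
by apply/funext => x; rewrite (big_nth (0, 0)) big_mkord.
Qed.

Lemma eq_toric_fun f g : (forall x, toric_points Lambda x -> f x = g x) ->
  toric_fun f -> toric_fun g.
Proof.
by move=> fg [S [hS hf]]; exists S; split=> // x Tx; rewrite -fg// hf.
Qed.

Lemma toric_fun_monomial u : Lambda u -> toric_fun (fun x => x u).
Proof.
move=> Lu; exists [:: (1, u)]; split=> [p|x _]; first by rewrite inE => /eqP ->.
by rewrite big_seq1 mul1r.
Qed.

Lemma toric_fun0 : toric_fun (fun=> 0).
Proof. by exists [::]; split=> // x _; rewrite big_nil. Qed.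

Lemma toric_funD f g : toric_fun f -> toric_fun g ->
  toric_fun (fun x => f x + g x).
Proof.
move=> [S [hS hf]] [S' [hS' hg]]; exists (S ++ S'); split=> [p|x Tx].
  by rewrite mem_cat => /orP[/hS|/hS'].
by rewrite big_cat hf// hg.
Qed.

Lemma toric_fun_sum I (r : seq I) (F : I -> (M -> k) -> k) :
  (forall i, toric_fun (F i)) -> toric_fun (fun x => \sum_(i <- r) F i x).
Proof.
move=> hF; elim: r => [|i r IHr].
  by apply: eq_toric_fun toric_fun0 => x _; rewrite big_nil.
by apply: eq_toric_fun (toric_funD (hF i) IHr) => x _; rewrite big_cons.
Qed.

Hypotheses (Lambda0 : Lambda 0) (LambdaD : add_closed_set Lambda).

Lemma toric_funM f g : toric_fun f -> toric_fun g ->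
  toric_fun (fun x => f x * g x).
Proof.
move=> [S [hS hf]] [S' [hS' hg]].
exists [seq (p.1 * q.1, p.2 + q.2) | p <- S, q <- S']; split=> [p|x Tx].
  by case/allpairsP => -[a b] [/= /hS ha /hS' hb ->]; exact: LambdaD.
rewrite hf// hg// big_flatten big_map mulr_suml big_seq [RHS]big_seq.
apply: eq_bigr => p /hS hp; rewrite big_map mulr_sumr big_seq [RHS]big_seq.
apply: eq_bigr => q /hS' hq /=.
by case: Tx => _ /(_ _ _ hp hq) -> _; rewrite mulrACA.
Qed.

Lemma toric_fun_cst c : toric_fun (fun=> c).
Proof.
exists [:: (c, 0)]; split=> [p|x [x0 _ _]]; first by rewrite inE => /eqP ->.
by rewrite big_seq1 x0 mulr1.
Qed.

Lemma toric_fun_prod I (r : seq I) (F : I -> (M -> k) -> k) :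
  (forall i, toric_fun (F i)) -> toric_fun (fun x => \prod_(i <- r) F i x).
Proof.
move=> hF; elim: r => [|i r IHr].
  by apply: eq_toric_fun (toric_fun_cst 1) => x _; rewrite big_nil.
by apply: eq_toric_fun (toric_funM (hF i) IHr) => x _; rewrite big_cons.
Qed.

Lemma toric_funX n f : toric_fun f -> toric_fun (fun x => f x ^+ n).
Proof.
move=> hf; elim: n => [|n IHn].
  by apply: eq_toric_fun (toric_fun_cst 1) => x _; rewrite expr0.
by apply: eq_toric_fun (toric_funM hf IHn) => x _; rewrite exprS.
Qed.

Lemma toric_fun_horner (p : {poly k}) f : toric_fun f ->
  toric_fun (fun x => p.[f x]).
Proof.
move=> hf; apply: (@eq_toric_fun
    (fun x => \sum_(i <- enum 'I_(size p)) p`_i * f x ^+ i)).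
  by move=> x _; rewrite big_enum horner_coef.
by apply: toric_fun_sum => i; apply: toric_funM (toric_fun_cst _) (toric_funX _ hf).
Qed.

Lemma regular_onP U phi : U `<=` toric_points Lambda ->
  regular_on (affine_toric k Lambda) U phi <->
  forall x, U x -> exists f g, [/\ toric_fun f, toric_fun g, g x != 0 &
         forall y, U y -> g y != 0 -> phi y = f y / g y].
Proof.
move=> UT; split=> h x Ux; have [f [g [hf hg gx fg]]] := h x Ux.
  by exists f, g; split=> //; exact: toric_polys_fun.
have [f' hf' ff'] := toric_fun_polys hf.
have [g' hg' gg'] := toric_fun_polys hg.
exists f', g'; split=> //; first by rewrite -gg'//; exact: UT.
move=> y Uy; have Ty := UT _ Uy; rewrite -gg'// -ff'//.
exact: fg.
Qed.

Lemma opensP U : opens (affine_toric k Lambda) U <->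
  U `<=` toric_points Lambda /\
  forall x, U x -> exists2 f, toric_fun f &
    f x != 0 /\ forall y, toric_points Lambda y -> f y != 0 -> U y.
Proof.
split=> -[UT h]; split=> // x Ux; have [f hf [fx fU]] := h x Ux.
  by exists f => //; exact: toric_polys_fun.
have [f' hf' ff'] := toric_fun_polys hf.
exists f' => //; split=> [|y Ty]; first by rewrite -ff'//; exact: UT.
by rewrite -ff'//; exact: fU.
Qed.

End ToricFunctions.

Lemma group_terms (k : pzRingType) (M : eqType) (S : seq (k * M)) (F : M -> k) :
  \sum_(p <- S) p.1 * F p.2 =
  \sum_(v <- undup [seq p.2 | p <- S]) (\sum_(p <- S | p.2 == v) p.1) * F v.
Proof.
under [RHS]eq_bigr do rewrite mulr_suml.
rewrite (exchange_big_dep predT)//= big_seq [RHS]big_seq.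
apply: eq_bigr => p pS; rewrite -big_filter.
rewrite (@eq_filter _ _ (pred1 p.2)); last by move=> v /=; rewrite eq_sym.
by rewrite filter_pred1_uniq ?undup_uniq ?mem_undup ?map_f// big_seq1.
Qed.

Section Units.
Variable k : closedFieldType.

Lemma poly_eq0_units (P : {poly k}) : (forall s : k, s != 0 -> P.[s] = 0) -> P = 0.
Proof.
move=> hP; apply/eqP/negPn/negP => P0.
have /closed_nonrootP[s] : P * 'X != 0 by rewrite mulf_neq0// polyX_eq0.
by rewrite rootM rootX negb_or => /andP[+ /hP]; rewrite /root => /negP + /eqP.
Qed.

Lemma units_infinite n : exists xi : 'I_n -> k,
  injective xi /\ forall t, xi t != 0.
Proof.
suff [s [ss us]] : exists s : seq k, size s = n /\ uniq (0 :: s).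
  move: us => /= /andP[s0 us]; exists (fun t => nth 0 s t); split.
    move=> i j /eqP; rewrite nth_uniq ?ss// => /eqP; exact: val_inj.
  by move=> t; apply: contraNneq s0 => <-; rewrite mem_nth ?ss.
elim: n => [|n [s [ss us]]]; first by exists [::].
have /closed_nonrootP[x] : \prod_(a <- 0 :: s) ('X - a%:P) != 0.
  by rewrite prodf_seq_neq0; apply/allP => a _; rewrite polyXsubC_eq0.
rewrite root_prod_XsubC inE negb_or => /andP[x0 xs].
exists (x :: s); rewrite /= ss; split=> //; move: us => /= /andP[s0 ->].
by rewrite inE negb_or eq_sym x0 s0 xs.
Qed.

(* In lowest terms the denominator has no root but [0], hence is a power of the
   variable up to a constant. *)
Lemma rational_on_units n (g : k -> k) (P Q : {poly k}) :
  (size P <= n)%N -> (size Q <= n)%N -> Q != 0 ->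
  (forall s : k, s != 0 -> Q.[s] != 0 -> g s = P.[s] / Q.[s]) ->
  (forall xi : k, xi != 0 -> exists p q : {poly k}, q.[xi] != 0 /\
     forall s : k, s != 0 -> q.[s] != 0 -> g s = p.[s] / q.[s]) ->
  exists G : {poly k}, (size G <= n + n)%N /\
    forall s : k, s != 0 -> g s * s ^+ n = G.[s].
Proof.
move=> sP sQ Q0 gPQ gloc.
have R0 : gcdp P Q != 0 by rewrite gcdp_eq0 negb_and Q0 orbT.
set R := gcdp P Q in R0.
have PE : P = P %/ R * R by rewrite divpK// dvdp_gcdl.
have QE : Q = Q %/ R * R by rewrite divpK// dvdp_gcdr.
have cop : coprimep (P %/ R) (Q %/ R) by rewrite coprimep_div_gcd// Q0 orbT.
set P1 := P %/ R in PE cop; set Q1 := Q %/ R in QE cop.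
have Q10 : Q1 != 0 by apply: contraNneq Q0 => Q10; rewrite QE Q10 mul0r.
have cross xi p q : q.[xi] != 0 ->
    (forall s : k, s != 0 -> q.[s] != 0 -> g s = p.[s] / q.[s]) -> p * Q1 = P1 * q.
  move=> qxi gpq; have q0 : q != 0 by apply: contraNneq qxi => ->; rewrite horner0.
  have : (p * Q - P * q) * (Q * q) = 0.
    apply: poly_eq0_units => s s0; rewrite hornerM [(Q * q).[s]]hornerM.
    have [->|Qs] := eqVneq Q.[s] 0; first by rewrite mul0r mulr0.
    have [->|qs] := eqVneq q.[s] 0; first by rewrite !mulr0.
    rewrite hornerD hornerN !hornerM.
    have := gPQ s s0 Qs; rewrite gpq// => /eqP.
    by rewrite eqr_div// => /eqP ->; rewrite subrr mul0r.
  move/eqP; rewrite mulf_eq0 (negPf (mulf_neq0 Q0 q0)) orbF subr_eq0.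
  rewrite PE {1}QE mulrA [P1 * R * q]mulrAC => /eqP e; exact: (mulIf R0 e).
have noroot (xi : k) : xi != 0 -> Q1.[xi] != 0.
  move=> xi0; have [p [q [qxi gpq]]] := gloc xi xi0.
  have := cross _ _ _ qxi gpq => /(congr1 (horner^~ xi)); rewrite !hornerM => e.
  apply: contraTneq cop => Q1xi; apply/negP => cop.
  move: e; rewrite Q1xi mulr0 => /esym/eqP; rewrite mulf_eq0 (negPf qxi) orbF => P1xi.
  by have := coprimep_root cop P1xi; rewrite Q1xi eqxx.
have [c [a [c0 Q1E]]] : exists c a, c != 0 /\ Q1 = c *: 'X^a.
  have [r rE] := closed_field_poly_normal Q1.
  exists (lead_coef Q1), (size r); split; first by rewrite lead_coef_eq0.
  rewrite {1}rE; congr (_ *: _).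
  rewrite big_seq (eq_bigr (fun=> 'X)); last first.
    move=> z zr; suff -> : z = 0 by rewrite subr0.
    apply/eqP/negPn/negP => /noroot; rewrite rE hornerZ mulf_eq0 negb_or => /andP[_].
    by apply/negP/negPn; rewrite -/(root _ z) root_prod_XsubC.
  by rewrite -big_seq big_const_seq count_predT iter_mulr_1.
have an : (a < n)%N.
  have : (size Q1 <= n)%N by apply: leq_trans sQ; exact: leq_divp.
  by rewrite Q1E size_scale// size_polyXn.
exists (c^-1 *: (P1 * 'X^(n - a))); split.
  apply: leq_trans (size_scale_leq _ _) _.
  apply: leq_trans (size_polyMleq _ _) _; rewrite size_polyXn.
  rewrite addnS leq_add ?leq_subr//.
  by apply: leq_trans sP; exact: leq_divp.
move=> s s0; have [p [q [qs gpq]]] := gloc s s0.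
have := cross _ _ _ qs gpq => /(congr1 (horner^~ s)); rewrite !hornerM Q1E.
rewrite !hornerZ !hornerXn hornerM hornerXn => e.
have sa : s ^+ a != 0 by rewrite expf_neq0.
rewrite gpq// -(subnK (ltnW an)) exprD addnK.
have -> : P1.[s] = p.[s] * (c * s ^+ a) / q.[s] by rewrite e mulfK.
by field; rewrite c0 qs.
Qed.

End Units.

(** * The torus *)

Section Torus.
Variables (k : closedFieldType) (d : nat).
Local Notation MZ := 'rV[int]_d.
Local Notation torus := (@toric_points k MZ setT).
Implicit Types (x y : MZ -> k) (u v w : MZ) (S : seq (k * MZ)).

Lemma torusD x u v : torus x -> x (u + v) = x u * x v.
Proof. by case=> _ + _; apply. Qed.

Lemma torus_neq0 x u : torus x -> x u != 0.
Proof.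
move=> Tx; apply/eqP => xu0; have := torusD u (- u) Tx.
by rewrite subrr xu0 mul0r; case: Tx => -> _ _ /eqP; rewrite oner_eq0.
Qed.

Lemma torusN x u : torus x -> x (- u) = (x u)^-1.
Proof.
move=> Tx; apply: (mulfI (torus_neq0 u Tx)).
by rewrite -torusD// subrr mulfV ?torus_neq0//; case: Tx.
Qed.

Lemma torusMz x u (z : int) : torus x -> x (z *: u) = x u ^ z.
Proof.
move=> Tx; have h n : x (n%:Z *: u) = x u ^+ n.
  elim: n => [|n IHn]; first by rewrite scale0r expr0; case: Tx.
  by rewrite intS scalerDl scale1r torusD// IHn exprS.
case: z => n; first exact: h.
by rewrite NegzE scaleNr torusN// h.
Qed.

Lemma torus_ext x y : torus x -> torus y ->
  (forall l, x (delta_mx ord0 l) = y (delta_mx ord0 l)) -> x = y.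
Proof.
move=> Tx Ty xy; apply/funext => u; rewrite [u]row_sum_delta.
apply: (big_ind (fun v => x v = y v)) => [|v v' ev ev'|l _].
- by case: Tx Ty => -> _ _ [-> _ _].
- by rewrite !torusD// ev ev'.
- by rewrite !torusMz// xy.
Qed.

Lemma torus_one : torus (fun=> 1).
Proof. by split=> // [u v|u []]//; rewrite mulr1. Qed.

Definition twist x w (s : k) : MZ -> k := fun u => x u * s ^ dot w u.

Lemma torus_twist x w s : torus x -> s != 0 -> torus (twist x w s).
Proof.
move=> Tx s0; split=> [|u v _ _|u []//]; rewrite /twist.
  by rewrite linear0 expr0z mulr1; case: Tx.
by rewrite torusD// linearD expfzDr// mulrACA.
Qed.

Definition line_poly x w N S : {poly k} :=
  \sum_(p <- S) (p.1 * x p.2) *: 'X^`|(dot w p.2 + N%:Z)%R|.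

Lemma exponent_bound w S : exists N : nat, forall p, p \in S -> `|dot w p.2| <= N%:Z.
Proof.
exists (\max_(p <- S) `|dot w p.2|)%N => p pS.
by rewrite -abszE lez_nat; apply: (leq_bigmax_seq p).
Qed.

Section LinePoly.
Variables (x : MZ -> k) (w : MZ) (N : nat) (S : seq (k * MZ)).
Hypothesis hN : forall p, p \in S -> `|dot w p.2| <= N%:Z.

Lemma size_line_poly : (size (line_poly x w N S) <= (N + N).+1)%N.
Proof.
rewrite /line_poly big_seq; apply: (big_ind (fun P : {poly k} => (size P <= _)%N)).
- by rewrite size_poly0.
- by move=> P Q sP sQ; rewrite (leq_trans (size_polyD _ _))// geq_max sP.
- move=> p /hN; rewrite ler_norml => hp.
  rewrite (leq_trans (size_scale_leq _ _))// size_polyXn.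
  by move: hp; move: (dot w p.2) => n; lia.
Qed.

Lemma horner_line_poly (s : k) : s != 0 ->
  (line_poly x w N S).[s] = (\sum_(p <- S) p.1 * twist x w s p.2) * s ^+ N.
Proof.
move=> s0; rewrite /line_poly horner_sum mulr_suml big_seq [RHS]big_seq.
apply: eq_bigr => p /hN; rewrite ler_norml => hp.
rewrite hornerZ hornerXn /twist -!mulrA; congr (_ * (_ * _)).
have -> : s ^+ N = s ^ N%:Z by [].
have h0 : 0 <= dot w p.2 + N%:Z by move: hp; move: (dot w p.2) => n; lia.
by rewrite -expfzDr// -[in RHS](ger0_norm h0) -abszE.
Qed.

Lemma coef_line_poly v : `|dot w v| <= N%:Z ->
  (forall p, p \in S -> dot w p.2 = dot w v -> p.2 = v) ->
  (line_poly x w N S)`_`|(dot w v + N%:Z)%R| = (\sum_(p <- S | p.2 == v) p.1) * x v.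
Proof.
move=> hv sep; rewrite /line_poly coef_sum mulr_suml [RHS]big_mkcond big_seq [RHS]big_seq.
apply: eq_bigr => p pS; rewrite coefZ coefXn.
move: hv (hN pS); rewrite !ler_norml => hv hp.
have -> : (`|(dot w v + N%:Z)%R| == `|(dot w p.2 + N%:Z)%R|)%N = (p.2 == v).
  apply/eqP/eqP => [e|-> //]; apply: sep => //; move: e hv hp.
  by move: (dot w v) (dot w p.2) => n n'; lia.
by case: eqP => [->|_]; rewrite ?mulr1 ?mulr0.
Qed.

End LinePoly.

(* [w] separates the exponents, so that along [s |-> s ^ <w, _>] distinct
   monomials become distinct powers of [s]. *)
Lemma separating_functional (Ss : seq MZ) : exists w : MZ,
  forall u v, u \in Ss -> v \in Ss -> dot w u = dot w v -> u = v.
Proof.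
have [w hw] := avoid_hyperplanes [seq u - v | u <- Ss, v <- Ss].
exists w => u v uS vS /eqP uv; apply/eqP; rewrite -subr_eq0.
apply: contraTT uv => uv; rewrite -subr_eq0 -linearB; apply: hw => //.
by apply/allpairsP; exists (u, v).
Qed.

Lemma torus_coef S : (forall x, torus x -> \sum_(p <- S) p.1 * x p.2 = 0) ->
  forall v, \sum_(p <- S | p.2 == v) p.1 = 0.
Proof.
move=> hS v; pose x1 : MZ -> k := fun=> 1.
have [w hw] := separating_functional (v :: [seq p.2 | p <- S]).
have [N] := exponent_bound w ((1, v) :: S); set S' := _ :: _ => hN.
have hN' p : p \in S -> `|dot w p.2| <= N%:Z by move=> pS; apply: hN; rewrite inE pS orbT.
have P0 : line_poly x1 w N S = 0.
  apply: poly_eq0_units => s s0; rewrite horner_line_poly// hS ?mul0r//.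
  exact: torus_twist torus_one s0.
have := @coef_line_poly x1 w N S hN' v (hN (1, v) (mem_head _ _)).
rewrite P0 coef0 mulr1 => <- // p pS.
by apply: hw; rewrite ?mem_head// inE map_f// orbT.
Qed.

Lemma torus_sum_eq0 S : (forall x, torus x -> \sum_(p <- S) p.1 * x p.2 = 0) ->
  forall F : MZ -> k, \sum_(p <- S) p.1 * F p.2 = 0.
Proof.
move=> hS F; rewrite group_terms big1// => v _.
by rewrite torus_coef// mul0r.
Qed.

(* The torus is irreducible. *)
Lemma torus_dense (f g : (MZ -> k) -> k) (y : MZ -> k) :
  toric_fun setT f -> toric_fun setT g -> torus y -> g y != 0 ->
  (forall x, torus x -> g x != 0 -> f x = 0) -> forall x, torus x -> f x = 0.
Proof.
move=> [S [_ hf]] [S' [_ hg]] Ty gy fg x Tx; rewrite hf//.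
rewrite hg// in gy; pose x1 : MZ -> k := fun=> 1.
have [w hw] := separating_functional [seq p.2 | p <- S ++ S'].
have [N hN] := exponent_bound w (S ++ S').
have key S'' : {subset S'' <= S ++ S'} -> line_poly x1 w N S'' = 0 ->
    forall F : MZ -> k, \sum_(p <- S'') p.1 * F p.2 = 0.
  move=> sS P0 F; rewrite group_terms big_seq big1// => v.
  rewrite mem_undup => /mapP[q qS ->].
  have := @coef_line_poly x1 w N S'' (fun p pS => hN p (sS p pS)) q.2 (hN q (sS q qS)).
  rewrite P0 coef0 mulr1 => <-; first by rewrite mul0r.
  by move=> p pS; apply: hw; apply: map_f; exact: sS.
have sS : {subset S <= S ++ S'} by move=> p pS; rewrite mem_cat pS.
have sS' : {subset S' <= S ++ S'} by move=> p pS; rewrite mem_cat pS orbT.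
apply: (key S sS); have : line_poly x1 w N S * line_poly x1 w N S' = 0.
  apply: poly_eq0_units => s s0; have Ts := torus_twist w torus_one s0.
  rewrite hornerM !horner_line_poly//; try by move=> p /sS'/hN.
    rewrite -hf// -hg//; have [->|/fg->//] := eqVneq (g (twist x1 w s)) 0.
      by rewrite mul0r mulr0.
    by rewrite !mul0r.
  by move=> p /sS/hN.
move/eqP; rewrite mulf_eq0 => /orP[/eqP //|/eqP P0].
by rewrite (key S' sS' P0) eqxx in gy.
Qed.

Definition set_coord (l : 'I_d) (xi : k) x : MZ -> k :=
  twist x (delta_mx ord0 l) (xi / x (delta_mx ord0 l)).

Lemma torus_set_coord l xi x : xi != 0 -> torus x -> torus (set_coord l xi x).
Proof.
by move=> xi0 Tx; apply: torus_twist => //; rewrite mulf_neq0// invr_neq0// torus_neq0.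
Qed.

Lemma set_coordE l xi x l' : torus x ->
  set_coord l xi x (delta_mx ord0 l') =
  if l' == l then xi else x (delta_mx ord0 l').
Proof.
move=> Tx; rewrite /set_coord /twist dot_delta mxE eqxx /= eq_sym.
case: eqP => [->|_]; last by rewrite expr0z mulr1.
by rewrite expr1z mulrCA mulfV ?mulr1// torus_neq0.
Qed.

Lemma set_coord_twist l xi s x : xi != 0 -> s != 0 -> torus x ->
  set_coord l s x = twist (set_coord l xi x) (delta_mx ord0 l) (s / xi).
Proof.
move=> xi0 s0 Tx; apply/funext => u; rewrite /set_coord /twist -mulrA -expfzMl.
by congr (_ * _ ^ _); field; rewrite xi0 torus_neq0.
Qed.

Lemma set_coord_id l x : torus x -> set_coord l (x (delta_mx ord0 l)) x = x.
Proof.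
move=> Tx; apply/funext => u; rewrite /set_coord /twist divff ?torus_neq0//.
by rewrite exp1rz mulr1.
Qed.

Lemma toric_fun_torus_pow u (z : int) : toric_fun setT (fun x => (x u) ^ z).
Proof.
apply: (eq_toric_fun _ (@toric_fun_monomial k _ setT (z *: u) I)) => x Tx.
exact: torusMz.
Qed.

Lemma toric_fun_set_coord l xi f : xi != 0 -> toric_fun setT f ->
  toric_fun setT (f \o set_coord l xi).
Proof.
move=> xi0 [S [_ hf]]; pose F (p : k * MZ) x := p.1 * set_coord l xi x p.2.
apply: (@eq_toric_fun _ _ _ (fun x => \sum_(p <- S) F p x)).
  by move=> x Tx /=; rewrite hf//; exact: torus_set_coord.
apply: toric_fun_sum => p; have TD : add_closed_set (setT : set MZ) by [].
apply: toric_funM => //; first exact: toric_fun_cst.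
apply: toric_funM => //; first exact: toric_fun_monomial.
apply: (eq_toric_fun _ (toric_funM TD
  (toric_fun_cst (I : setT 0) (xi ^ dot (delta_mx ord0 l) p.2))
  (toric_fun_torus_pow (delta_mx ord0 l) (- dot (delta_mx ord0 l) p.2)))).
by move=> x Tx; rewrite expfzMl exprz_inv.
Qed.

Definition torus_regular (f : (MZ -> k) -> k) : Prop :=
  forall x, torus x -> exists f1 g1,
    [/\ toric_fun setT f1, toric_fun setT g1, g1 x != 0 &
        forall y, torus y -> g1 y != 0 -> f y = f1 y / g1 y].

Let T0 : (setT : set MZ) 0. Proof. by []. Qed.
Let TD : add_closed_set (setT : set MZ). Proof. by []. Qed.

Lemma eq_torus_regular f g : (forall x, torus x -> f x = g x) ->
  torus_regular f -> torus_regular g.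
Proof.
move=> fg rf x Tx; have [f1 [g1 [hf hg gx e]]] := rf x Tx.
by exists f1, g1; split=> // y Ty gy; rewrite -fg// e.
Qed.

Lemma torus_regular_fun f : toric_fun setT f -> torus_regular f.
Proof.
move=> hf x Tx; exists f, (fun=> 1); split=> //; first exact: toric_fun_cst.
  exact: oner_neq0.
by move=> y _ _; rewrite divr1.
Qed.

Lemma torus_regularD f g : torus_regular f -> torus_regular g ->
  torus_regular (fun x => f x + g x).
Proof.
move=> rf rg x Tx; have [f1 [g1 [hf1 hg1 g1x e1]]] := rf x Tx.
have [f2 [g2 [hf2 hg2 g2x e2]]] := rg x Tx.
exists (fun y => f1 y * g2 y + f2 y * g1 y), (fun y => g1 y * g2 y); split.
- by apply: toric_funD; apply: toric_funM.
- exact: toric_funM.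
- by rewrite mulf_neq0.
- move=> y Ty; rewrite mulf_eq0 negb_or => /andP[g1y g2y].
  by rewrite e1// e2//; field; rewrite g1y g2y.
Qed.

Lemma torus_regularM f g : torus_regular f -> torus_regular g ->
  torus_regular (fun x => f x * g x).
Proof.
move=> rf rg x Tx; have [f1 [g1 [hf1 hg1 g1x e1]]] := rf x Tx.
have [f2 [g2 [hf2 hg2 g2x e2]]] := rg x Tx.
exists (fun y => f1 y * f2 y), (fun y => g1 y * g2 y); split.
- exact: toric_funM.
- exact: toric_funM.
- by rewrite mulf_neq0.
- move=> y Ty; rewrite mulf_eq0 negb_or => /andP[g1y g2y].
  by rewrite e1// e2//; field; rewrite g1y g2y.
Qed.

Lemma torus_regular_sum n (F : 'I_n -> (MZ -> k) -> k) :
  (forall i, torus_regular (F i)) -> torus_regular (fun x => \sum_i F i x).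
Proof.
elim: n F => [|n IHn] F hF.
  apply: (eq_torus_regular _ (torus_regular_fun (@toric_fun0 k MZ setT))).
  by move=> x _; rewrite big_ord0.
apply: (eq_torus_regular _
  (torus_regularD (hF ord0) (IHn _ (fun i => hF (lift ord0 i))))).
by move=> x _; rewrite big_ord_recl.
Qed.

Lemma torus_regular_set_coord l xi f : xi != 0 -> torus_regular f ->
  torus_regular (f \o set_coord l xi).
Proof.
move=> xi0 rf x Tx.
have [f1 [g1 [hf hg gx e]]] := rf _ (torus_set_coord l xi0 Tx).
exists (f1 \o set_coord l xi), (g1 \o set_coord l xi); split=> //.
- exact: toric_fun_set_coord.
- exact: toric_fun_set_coord.
- by move=> y Ty /=; apply: e; exact: torus_set_coord.
Qed.

Lemma torus_regular_dense f g y : torus_regular f -> toric_fun setT g ->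
  torus y -> g y != 0 -> (forall x, torus x -> g x != 0 -> f x = 0) ->
  forall x, torus x -> f x = 0.
Proof.
move=> rf hg Ty gy fg x Tx; have [f1 [g1 [hf1 hg1 g1x e]]] := rf x Tx.
have h z : torus z -> f1 z * g1 z = 0.
  apply: (torus_dense (toric_funM TD hf1 hg1) hg Ty gy) => {}z Tz gz.
  have [->|g1z] := eqVneq (g1 z) 0; first by rewrite mulr0.
  have := fg z Tz gz; rewrite e// => /eqP.
  by rewrite mulf_eq0 invr_eq0 (negPf g1z) orbF => /eqP ->; rewrite mul0r.
by rewrite e//; have /eqP := h x Tx;
  rewrite mulf_eq0 (negPf g1x) orbF => /eqP ->; rewrite mul0r.
Qed.

End Torus.

Lemma interpolation (F : fieldType) n (xi : 'I_n -> F) : injective xi ->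
  exists ell : 'I_n -> {poly F}, forall G : {poly F}, (size G <= n)%N ->
    G = \sum_t G.[xi t] *: ell t.
Proof.
move=> xiI; pose V := Vandermonde n (\row_t xi t).
have Vu : V \in unitmx.
  rewrite unitmxE unitfE det_Vandermonde; apply/prodf_neq0 => i _.
  apply/prodf_neq0 => j ij; rewrite !mxE subr_eq0.
  by apply: contraTneq ij => /xiI ->; rewrite ltnn.
exists (fun t => rVpoly (row t (invmx V))) => G sG.
have valE : \row_t G.[xi t] = poly_rV G *m V.
  apply/rowP => t; rewrite !mxE (horner_coef_wide _ sG).
  by apply: eq_bigr => i _; rewrite !mxE.
rewrite -[LHS](poly_rV_K sG) -[poly_rV G](mulmxK Vu) -valE mulmx_sum_row linear_sum.
by apply: eq_bigr => t _; rewrite linearZ mxE.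
Qed.

Section TorusRegular.
Variables (k : closedFieldType) (d : nat).
Local Notation MZ := 'rV[int]_d.
Local Notation torus := (@toric_points k MZ setT).
Implicit Types (x y : MZ -> k) (f : (MZ -> k) -> k).

Let T0 : (setT : set MZ) 0. Proof. by []. Qed.
Let TD : add_closed_set (setT : set MZ). Proof. by []. Qed.

(* On the line through [x] in direction [l], [f] is a Laurent polynomial whose
   degree is bounded by those of a global expression [f1 / g1]; this needs [g1]
   not to vanish identically on the line, but the resulting interpolation
   formula extends to all [x] by density. *)
Lemma torus_regular_interp f (l : 'I_d) : torus_regular f ->
  exists n (xi : 'I_n -> k) (L : 'I_n -> (MZ -> k) -> k),
    [/\ forall t, xi t != 0, forall t, toric_fun setT (L t) &
        forall x, torus x -> f x = \sum_t L t x * f (set_coord l (xi t) x)].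
Proof.
move=> rf; pose e : MZ := delta_mx ord0 l.
have [f1 [g1 [hf1 hg1 g10 e1]]] := rf _ (torus_one k d).
have [S [_ hS]] := hf1; have [S' [_ hS']] := hg1.
have [N hN] := exponent_bound e (S ++ S').
have hNS p : p \in S -> `|dot e p.2| <= N%:Z.
  by move=> pS; apply: hN; rewrite mem_cat pS.
have hNS' p : p \in S' -> `|dot e p.2| <= N%:Z.
  by move=> pS; apply: hN; rewrite mem_cat pS orbT.
pose n0 := (N + N).+1.
have [xi [xiI xi0]] := units_infinite k (n0 + n0).
have [ell hell] := interpolation xiI.
pose L t x := x e ^ (- n0%:Z) * (xi t ^+ n0 * (ell t).[x e]).
have hL t : toric_fun setT (L t).
  apply: toric_funM => //; first exact: toric_fun_torus_pow.
  apply: toric_funM => //; first exact: toric_fun_cst.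
  by apply: toric_fun_horner => //; exact: toric_fun_monomial.
exists (n0 + n0)%N, xi, L; split=> //.
suff main x : torus x -> g1 x != 0 ->
    f x = \sum_t L t x * f (set_coord l (xi t) x).
  move=> x Tx; apply/eqP; rewrite -subr_eq0 -mulN1r; apply/eqP.
  apply: (@torus_regular_dense _ _ (fun x =>
      f x + -1 * \sum_t L t x * f (set_coord l (xi t) x)) _ _ _ hg1
      (torus_one k d) g10) => //.
    apply: torus_regularD => //; apply: torus_regularM.
      by apply: torus_regular_fun; exact: toric_fun_cst.
    apply: torus_regular_sum => t; apply: torus_regularM.
      exact: torus_regular_fun.
    by apply: torus_regular_set_coord.
  by move=> y Ty gy; rewrite {1}main// mulN1r subrr.
move=> Tx gx; pose x1 := set_coord l 1 x.
have T1 : torus x1 by apply: torus_set_coord; rewrite ?oner_neq0.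
have lineE s : s != 0 -> set_coord l s x = twist x1 e s.
  by move=> s0; rewrite (@set_coord_twist _ _ l 1)// ?oner_neq0// divr1.
pose g s := f (set_coord l s x).
have xe0 : x e != 0 by exact: torus_neq0.
have [|||||G [sG GE]] := @rational_on_units k n0 g
  (line_poly x1 e N S) (line_poly x1 e N S').
- exact: size_line_poly.
- exact: size_line_poly.
- apply: contraNneq gx => P0; rewrite hS'//.
  have := @horner_line_poly k d x1 e N S' hNS' (x e) xe0.
  rewrite P0 horner0 -lineE// set_coord_id// => /esym/eqP.
  by rewrite mulf_eq0 expf_eq0 (negPf xe0) andbF orbF.
- move=> s s0; have Ts : torus (set_coord l s x) by exact: torus_set_coord.
  rewrite !horner_line_poly// -lineE// -hS// -hS'// mulf_eq0 negb_or => /andP[g1s _].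
  by rewrite /g e1//; field; rewrite g1s expf_neq0.
- move=> z z0; have Tz : torus (set_coord l z x) by exact: torus_set_coord.
  have [f2 [g2 [[S2 [_ hS2]] [S2' [_ hS2']] g2z e2]]] := rf _ Tz.
  have [N2 hN2] := exponent_bound e (S2 ++ S2').
  have hN2S p : p \in S2 -> `|dot e p.2| <= N2%:Z.
    by move=> pS; apply: hN2; rewrite mem_cat pS.
  have hN2S' p : p \in S2' -> `|dot e p.2| <= N2%:Z.
    by move=> pS; apply: hN2; rewrite mem_cat pS orbT.
  exists (line_poly x1 e N2 S2), (line_poly x1 e N2 S2'); split.
    by rewrite horner_line_poly// -lineE// -hS2'// mulf_neq0// expf_neq0.
  move=> s s0; have Ts : torus (set_coord l s x) by exact: torus_set_coord.
  rewrite !horner_line_poly// -lineE// -hS2// -hS2'// mulf_eq0 negb_or => /andP[g2s _].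
  by rewrite /g e2//; field; rewrite g2s expf_neq0.
have fE : f x = g (x e) by rewrite /g set_coord_id.
have xn0 : x e ^+ n0 != 0 by rewrite expf_neq0.
apply: (mulIf xn0); rewrite {1}fE GE// (hell G sG) horner_sum mulr_suml.
apply: eq_bigr => t _; rewrite hornerZ -GE// /L -/(g _) -exprnN.
by field.
Qed.

Lemma torus_regular_toric f : torus_regular f -> toric_fun setT f.
Proof.
suff gen (s : seq 'I_d) : forall f, torus_regular f ->
    (forall l (xi : k) x, l \notin s -> xi != 0 -> torus x ->
       f (set_coord l xi x) = f x) -> toric_fun setT f.
  by move=> rf; apply: (gen (enum 'I_d)) => // l xi x; rewrite mem_enum.
elim: s => [{}f rf inv|l s IHs {}f rf inv].
  have red (r : seq 'I_d) x : torus x -> exists2 y, torus y /\ f y = f x &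
      forall l, y (delta_mx ord0 l) = if l \in r then 1 else x (delta_mx ord0 l).
    move=> Tx; elim: r => [|l r [y [Ty fy] hy]]; first by exists x.
    exists (set_coord l 1 y).
      by split; [apply: torus_set_coord; rewrite ?oner_neq0|rewrite inv ?oner_neq0].
    by move=> l'; rewrite set_coordE// inE hy; case: eqP.
  apply: (eq_toric_fun _ (toric_fun_cst T0 (f (fun=> 1)))) => x Tx.
  have [y [Ty <-] hy] := red (enum 'I_d) x Tx; congr (f _).
  by apply: torus_ext (torus_one k d) Ty _ => l; rewrite hy mem_enum.
have [n [xi [L [xi0 hL fE]]]] := torus_regular_interp l rf.
apply: (@eq_toric_fun _ _ _ (fun x =>
    \sum_(t <- enum 'I_n) L t x * f (set_coord l (xi t) x))).
  by move=> x Tx; rewrite fE// big_enum.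
apply: toric_fun_sum => t; apply: toric_funM => //.
apply: IHs; first exact: torus_regular_set_coord.
move=> l' z x l's z0 Tx; have [->|l'l] := eqVneq l' l.
  congr (f _); apply: torus_ext => [||l2]; try by do ?[apply: torus_set_coord => //].
  rewrite !set_coordE//; last exact: torus_set_coord.
  by case: eqP.
rewrite -[RHS](inv l' z)//; last 2 first.
- by rewrite inE negb_or l'l.
- exact: torus_set_coord.
congr (f _); apply: torus_ext => [||l2]; try by do ?[apply: torus_set_coord => //].
rewrite !set_coordE//; try exact: torus_set_coord.
by case: eqP => // ->; rewrite eq_sym (negPf l'l).
Qed.

End TorusRegular.

(** * Rational cones *)

Section Cones.
Variables (R : realType) (d : nat).
Local Notation MZ := 'rV[int]_d.
Local Notation VR := 'rV[R]_d.
Local Notation cone := (set VR).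
Implicit Types (sigma tau : cone) (nu : VR) (u v : MZ).

Lemma pairing_dot : @pairing R d = @dot R d.
Proof. by []. Qed.

Lemma toRD u v : toR R (u + v) = toR R u + toR R v.
Proof. exact: raddfD. Qed.

Lemma toRN u : toR R (- u) = - toR R u.
Proof. exact: raddfN. Qed.

Lemma toR_eq0 u : toR R u = 0 -> u = 0.
Proof.
move=> /rowP u0; apply/rowP => i; have := u0 i.
by rewrite !mxE => /eqP; rewrite intr_eq0 => /eqP.
Qed.

Lemma pairing_int u v : pairing (toR R u) (toR R v) = (dot u v)%:~R.
Proof. exact: dot_map. Qed.

Lemma pairingDr nu u v :
  pairing nu (toR R (u + v)) = pairing nu (toR R u) + pairing nu (toR R v).
Proof. by rewrite toRD pairing_dot linearD. Qed.

Lemma pairingNr nu u : pairing nu (toR R (- u)) = - pairing nu (toR R u).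
Proof. by rewrite toRN pairing_dot linearN. Qed.

Lemma pairingBr nu u v :
  pairing nu (toR R (u - v)) = pairing nu (toR R u) - pairing nu (toR R v).
Proof. by rewrite pairingDr pairingNr. Qed.

Lemma pairing0r nu : pairing nu (toR R 0) = 0.
Proof. by rewrite /toR map_mx0 pairing_dot linear0. Qed.

Lemma pairing_sumZl n (c : 'I_n -> R) (a : 'I_n -> VR) (x : VR) :
  pairing (\sum_i c i *: a i) x = \sum_i c i * pairing (a i) x.
Proof.
rewrite pairing_dot dotC linear_sum; apply: eq_bigr => i _.
by rewrite linearZ dotC.
Qed.

Lemma pairing_sumZr n (c : 'I_n -> R) (a : 'I_n -> VR) nu :
  pairing nu (\sum_i c i *: a i) = \sum_i c i * pairing nu (a i).
Proof.
by rewrite pairing_dot linear_sum; apply: eq_bigr => i _; rewrite linearZ.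
Qed.

Lemma rational_cone_gen sigma : rational_cone sigma ->
  exists n (a : 'I_n -> MZ), (forall i, sigma (toR R (a i))) /\
    forall nu, sigma nu <->
      exists2 c : 'I_n -> R, forall i, 0 <= c i & nu = \sum_i c i *: toR R (a i).
Proof.
move=> [A [/finite_seqP[s As] ->]]; exists (size s), (fun i => s`_i); split.
  move=> i; exists 1%N, (fun=> toR R s`_i), (fun=> 1).
  rewrite big_ord1 scale1r; do 2?split=> //.
  by exists s`_i => //; rewrite As /=; exact: mem_nth.
move=> nu; split.
  move=> [n [b [c [bc ->]]]].
  have /choice[f hf] : forall j, exists i : 'I_(size s), b j = toR R s`_i.
    move=> j; have [[u Au <-] _] := bc j; move: Au; rewrite As /= => us.
    by exists (Ordinal (etrans (index_mem u s) us)); rewrite /= nth_index.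
  exists (fun i => \sum_(j | f j == i) c j) => [i|].
    by apply: sumr_ge0 => j _; case: (bc j).
  rewrite (partition_big f predT)//=; apply: eq_bigr => i _.
  by rewrite scaler_suml; apply: eq_bigr => j /eqP <-; rewrite hf.
move=> [c c0 ->]; exists (size s), (fun i => toR R s`_i), c; split=> // i.
by split=> //; exists s`_i => //; rewrite As /=; exact: mem_nth.
Qed.

Lemma cone_bidual sigma nu : rational_cone sigma ->
  (forall x, dual_cone sigma x -> 0 <= pairing nu x) -> sigma nu.
Proof.
move=> /rational_cone_gen[n [a [sa sE]]] hnu; apply/sE.
have [y hy|c [c0 nuE]] := @farkas R d n (fun i => toR R (a i)) nu; last by exists c.
rewrite dotC; apply: hnu => _ /sE[c c0 ->]; rewrite pairing_sumZl.
by apply: sumr_ge0 => i _; rewrite mulr_ge0// pairing_dot dotC hy.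
Qed.

Lemma cone_interior_point sigma : rational_cone sigma ->
  exists2 w, sigma w & forall x, dual_cone sigma x -> pairing w x = 0 ->
    forall nu, sigma nu -> pairing nu x = 0.
Proof.
move=> /rational_cone_gen[n [a [sa sE]]]; exists (\sum_i 1 *: toR R (a i)).
  by apply/sE; exists (fun=> 1).
move=> x dx; rewrite pairing_sumZl => /eqP; rewrite psumr_eq0 => [|i _]; last first.
  by rewrite mul1r dx.
move=> /allP ax0 _ /sE[c _ ->]; rewrite pairing_sumZl big1// => i _.
by have /eqP := ax0 i (mem_index_enum i); rewrite mul1r => ->; rewrite mulr0.
Qed.

Lemma full_cone_span sigma (x : VR) : cone_dim sigma d ->
  (forall nu, sigma nu -> pairing nu x = 0) -> x = 0.
Proof.
move=> [U [dU sU minU]] sx.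
pose f : {linear VR -> R^o} := dot x.
pose V := lker (linfun f).
have UV : (U <= V)%VS.
  by apply: minU => nu /sx; rewrite memv_ker lfunE /= dotC pairing_dot => ->.
have Vfull : V = fullv.
  apply/eqP; rewrite eqEdim subvf/= dimvf; apply: leq_trans (dimvS UV).
  by rewrite dU /dim /= mul1n.
apply: dot_eq0 => y; have : y \in V by rewrite Vfull memvf.
by rewrite memv_ker lfunE /= dotC => /eqP.
Qed.

Lemma full_cone_or_orthogonal sigma : cone_dim sigma d \/
  exists2 x : VR, x != 0 & forall nu, sigma nu -> pairing nu x = 0.
Proof.
have [h|] := pselect (forall V : {vspace VR},
  (forall nu, sigma nu -> nu \in V) -> (fullv <= V)%VS).
  left; exists fullv; split=> //; last by move=> nu _; rewrite memvf.
  by rewrite dimvf /dim /= mul1n.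
move=> /existsNP[V /not_implyP[sV /negP/subvPn[v _ vV]]]; right.
have /eqP/rowP/existsNP[i] : v - projv V v != 0.
  apply: contraNneq vV => /eqP; rewrite subr_eq0 => /eqP ->; exact: memv_proj.
rewrite [X in _ <> X]mxE => vi.
pose f (y : VR) : R := (y - projv V y) ord0 i.
have f_lin : scalar f.
  move=> a y z; rewrite /f !linearP /= !mxE; ring.
pose F := GRing.isLinear.Build R VR R *%R f f_lin.
pose fl : {scalar VR} := HB.pack f F.
have fE y : f y = dot y (\row_j f (delta_mx ord0 j)) := linear_functionalE fl y.
exists (\row_j f (delta_mx ord0 j)).
  by apply: contra_notN vi => /eqP x0; rewrite -/(f v) fE x0 linear0.
move=> nu /sV nuV; rewrite pairing_dot -fE /f projv_id// subrr mxE//.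
Qed.

End Cones.

(** * Semigroups of a toric triple *)

Section Semigroups.
Variable M : zmodType.

Lemma semigroup_gen_min (A S : set M) :
  add_closed_set S -> A `<=` S -> semigroup_gen A `<=` S.
Proof. by move=> SD AS u; apply; split. Qed.

Lemma sub_semigroup_gen (A : set M) : A `<=` semigroup_gen A.
Proof. exact: sub_gen_smallest. Qed.

Lemma semigroup_genD (A : set M) : add_closed_set (semigroup_gen A).
Proof.
by move=> u v Au Av B h; apply: h.1; [exact: Au|exact: Av].
Qed.

Lemma group_gen_min (A S : set M) :
  subgroup_set S -> A `<=` S -> group_gen A `<=` S.
Proof. by move=> SD AS u; apply; split. Qed.

Lemma sub_group_gen (A : set M) : A `<=` group_gen A.
Proof. exact: sub_gen_smallest. Qed.

Lemma group_gen_subgroup (A : set M) : subgroup_set (group_gen A).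
Proof.
split=> [B [[]]//|u v Au Av B h|u Au B h]; have [[_ BD BN] _] := h.
- by apply: BD; [exact: Au|exact: Av].
- by apply: BN; exact: Au.
Qed.

Variable S : set M.
Hypotheses (S0 : S 0) (SD : add_closed_set S).

Lemma semigroupMn u n : S u -> S (u *+ n).
Proof. by move=> Su; elim: n => [|n IHn]; rewrite ?mulr0n// mulrS; exact: SD. Qed.

Lemma semigroup_sum I (r : seq I) (P : pred I) (F : I -> M) :
  (forall i, P i -> S (F i)) -> S (\sum_(i <- r | P i) F i).
Proof. by move=> hF; apply: big_ind. Qed.

Lemma toric_point_unit (k : fieldType) (x : M -> k) u :
  toric_points S x -> S u -> S (- u) -> x u != 0.
Proof.
move=> [x0 xD _] Su SNu; apply/eqP => xu0; have := xD _ _ Su SNu.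
by rewrite subrr x0 xu0 mul0r => /eqP; rewrite oner_eq0.
Qed.

Lemma toric_pointMn (k : fieldType) (x : M -> k) u n :
  toric_points S x -> S u -> x (u *+ n) = x u ^+ n.
Proof.
move=> [x0 xD _] Su; elim: n => [|n IHn]; first by rewrite mulr0n x0.
by rewrite mulrS xD ?IHn ?exprS//; exact: semigroupMn.
Qed.

Lemma toric_point_sum (k : fieldType) (x : M -> k) I (r : seq I) (F : I -> M) :
  toric_points S x -> (forall i, S (F i)) ->
  x (\sum_(i <- r) F i) = \prod_(i <- r) x (F i).
Proof.
move=> [x0 xD _] SF; elim: r => [|i r IHr]; first by rewrite !big_nil.
by rewrite !big_cons xD ?IHr//; apply: semigroup_sum.
Qed.

End Semigroups.

Section RestrictPoint.
Variables (k : fieldType) (M : zmodType).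
Implicit Types (L : set M) (x y : M -> k).

Lemma restrict_pointE L x u : L u -> restrict_point L x u = x u.
Proof. by move=> Lu; rewrite /restrict_point mem_set. Qed.

Lemma restrict_point_out L x u : ~ L u -> restrict_point L x u = 0.
Proof. by move=> Lu; rewrite /restrict_point memNset. Qed.

Lemma toric_points_restrict L L' x : L `<=` L' -> L 0 -> add_closed_set L ->
  toric_points L' x -> toric_points L (restrict_point L x).
Proof.
move=> LL' L0 LD [x0 xD _]; split=> [|u v Lu Lv|u Lu].
- by rewrite restrict_pointE.
- by rewrite !restrict_pointE//; [apply: xD; exact: LL'|exact: LD].
- by rewrite restrict_point_out.
Qed.

Lemma toric_points_ext L x y : toric_points L x -> toric_points L y ->
  (forall u, L u -> x u = y u) -> x = y.
Proof.
move=> [_ _ x_out] [_ _ y_out] xy; apply/funext => u.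
by have [/xy//|Lu] := pselect (L u); rewrite x_out// y_out.
Qed.

Lemma restrict_point_id L x : toric_points L x -> restrict_point L x = x.
Proof.
move=> [_ _ x_out]; apply/funext => u; have [Lu|Lu] := pselect (L u).
  by rewrite restrict_pointE.
by rewrite restrict_point_out// x_out.
Qed.

Lemma restrict_restrict L L' x : L `<=` L' ->
  restrict_point L (restrict_point L' x) = restrict_point L x.
Proof.
move=> LL'; apply/funext => u; have [Lu|Lu] := pselect (L u).
  by rewrite !restrict_pointE//; exact: LL'.
by rewrite !restrict_point_out.
Qed.

End RestrictPoint.

Section ToricTriple.
Variables (R : realType) (d : nat).
Local Notation MZ := 'rV[int]_d.
Local Notation VR := 'rV[R]_d.
Local Notation cone := (set VR).
Implicit Types (sigma tau rho : cone) (nu : VR) (u v w : MZ).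

Lemma face_sub tau sigma : face tau sigma -> tau `<=` sigma.
Proof. by move=> [x _ ->] nu []. Qed.

Lemma face_refl sigma : face sigma sigma.
Proof.
exists 0 => [nu _|]; first by rewrite pairing_dot linear0.
by apply/seteqP; split=> nu /= => [|[]//]; rewrite pairing_dot linear0.
Qed.

Variables (Sigma : set cone) (Gamma : cone -> set MZ).
Hypothesis hT : toric_triple Sigma Gamma.

Let fanS : fan Sigma. Proof. by case: hT. Qed.

Lemma triple_rational sigma : Sigma sigma -> rational_cone sigma.
Proof. by case: fanS => _ + _ _ => /[apply] -[]. Qed.

Lemma triple_face sigma tau : Sigma sigma -> face tau sigma -> Sigma tau.
Proof. by case: fanS => _ _ + _; apply. Qed.

Lemma triple_faceI sigma sigma' : Sigma sigma -> Sigma sigma' ->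
  face (sigma `&` sigma') sigma.
Proof. by move=> s s'; case: fanS => _ _ _ /(_ _ _ s s')[]. Qed.

Lemma triple_coneI sigma sigma' : Sigma sigma -> Sigma sigma' ->
  Sigma (sigma `&` sigma').
Proof. by move=> s s'; apply: triple_face (triple_faceI s s'). Qed.

Lemma triple_subface rho sigma : Sigma rho -> Sigma sigma -> rho `<=` sigma ->
  face rho sigma.
Proof.
by move=> hr hs rs; have := triple_faceI hs hr; rewrite setIC (setIidl rs).
Qed.

Lemma Gamma0 sigma : Sigma sigma -> Gamma sigma 0.
Proof.
case: hT => _ + _ _ => /[apply] -[[A [_ ->]] _].
by apply: sub_semigroup_gen; right.
Qed.

Lemma GammaD sigma : Sigma sigma -> add_closed_set (Gamma sigma).
Proof.
case: hT => _ + _ _ => /[apply] -[[A [_ ->]] _].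
exact: semigroup_genD.
Qed.

Lemma Gamma_dual sigma u : Sigma sigma -> Gamma sigma u ->
  dual_cone sigma (toR R u).
Proof. by case: hT => _ + _ _ => /[apply] -[_]; apply. Qed.

Lemma Gamma_ge0 sigma u nu : Sigma sigma -> Gamma sigma u -> sigma nu ->
  0 <= pairing nu (toR R u).
Proof. by move=> s su; exact: Gamma_dual. Qed.

Lemma Gamma_group sigma : Sigma sigma -> group_gen (Gamma sigma) = setT.
Proof. by case: hT => _ _ + _ => /[apply] -[]. Qed.

Lemma Gamma_hull sigma : Sigma sigma ->
  conic_hull (@toR R d @` Gamma sigma) = dual_cone sigma.
Proof. by case: hT => _ _ + _ => /[apply] -[]. Qed.

Lemma Gamma_face sigma tau : Sigma sigma -> face tau sigma ->
  Gamma tau = minkowski_sum (Gamma sigma) (face_lattice tau (Gamma sigma)).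
Proof. by case: hT => _ _ _; apply. Qed.

Lemma Gamma_sub sigma tau : Sigma sigma -> face tau sigma ->
  Gamma sigma `<=` Gamma tau.
Proof.
move=> hs ts u su; rewrite (Gamma_face hs ts); exists u => //.
exists 0; last by rewrite addr0.
by case: (group_gen_subgroup (Gamma sigma `&`
  [set v | forall nu, tau nu -> pairing nu (toR R v) = 0])).
Qed.

Lemma face_lattice_sub sigma tau : Sigma sigma -> face tau sigma ->
  face_lattice tau (Gamma sigma) `<=` Gamma tau.
Proof.
move=> hs ts u tu; rewrite (Gamma_face hs ts); exists 0; first exact: Gamma0.
by exists u => //; rewrite add0r.
Qed.

Lemma face_latticeN tau (L : set MZ) u : face_lattice tau L u ->
  face_lattice tau L (- u).
Proof.
by case: (group_gen_subgroup (L `&`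
  [set v | forall nu, tau nu -> pairing nu (toR R v) = 0])) => _ _; apply.
Qed.

(* [dual_cone sigma] is generated by [Gamma sigma] over the reals, hence over
   the rationals, by Farkas' lemma over both fields. *)
Lemma Gamma_multiple sigma u : Sigma sigma -> dual_cone sigma (toR R u) ->
  exists2 N, (0 < N)%N & Gamma sigma (u *+ N).
Proof.
move=> hs; rewrite -Gamma_hull// => -[n [a [c [ac uE]]]].
have /choice[g hg] : forall i, exists g, Gamma sigma g /\ toR R g = a i.
  by move=> i; case: (ac i) => -[g gs ga] _; exists g.
have [y hy|N [c' [N0 uN]]] := @int_farkas d n g u.
  rewrite -(ler0z R) -pairing_int uE pairing_sumZr; apply: sumr_ge0 => i _.
  case: (hg i) (ac i) => _ <- [_ ci]; rewrite mulr_ge0// pairing_int ler0z.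
  exact: hy.
exists N => //; rewrite uN; apply: semigroup_sum => [||i _].
- exact: Gamma0.
- exact: GammaD.
- by apply: semigroupMn; [exact: Gamma0|exact: GammaD|case: (hg i)].
Qed.

Lemma face_integral sigma tau : Sigma sigma -> face tau sigma ->
  exists2 u, Gamma sigma u &
    tau = sigma `&` [set nu | pairing nu (toR R u) = 0].
Proof.
move=> hs [x dx tauE]; move: (dx); rewrite -Gamma_hull// => -[n [a [c [ac xE]]]].
have /choice[g hg] : forall i, exists g, Gamma sigma g /\ toR R g = a i.
  by move=> i; case: (ac i) => -[g gs ga] _; exists g.
have gG i : Gamma sigma (g i) by case: (hg i).
exists (\sum_(i | 0 < c i) g i).
  by apply: semigroup_sum => [||i _//]; [exact: Gamma0|exact: GammaD].
have key nu : sigma nu -> (pairing nu x = 0 <->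
    pairing nu (toR R (\sum_(i | 0 < c i) g i)) = 0).
  move=> snu; have an i : 0 <= pairing nu (a i).
    by case: (hg i) => gi <-; exact: Gamma_ge0 hs gi snu.
  have -> : pairing nu (toR R (\sum_(i | 0 < c i) g i)) =
      \sum_(i | 0 < c i) pairing nu (a i).
    rewrite /toR raddf_sum pairing_dot linear_sum; apply: eq_bigr => i _.
    by case: (hg i) => _ <-.
  rewrite xE pairing_sumZr; split=> /eqP.
    rewrite psumr_eq0 => [/allP h|i _]; last by rewrite mulr_ge0//; case: (ac i).
    rewrite big1// => i ci; have := h i (mem_index_enum i).
    by rewrite /= mulf_eq0 gt_eqF//= => /eqP.
  rewrite psumr_eq0 => [/allP h|i _//]; rewrite big1// => i _.
  have [_ ci] := ac i; move: ci; rewrite le_eqVlt => /orP[/eqP <-|ci].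
    by rewrite mul0r.
  by have := h i (mem_index_enum i); rewrite ci => /eqP ->; rewrite mulr0.
by rewrite tauE; apply/seteqP; split=> nu [/= snu /key h]; split=> //; exact: h.
Qed.

Section FaceCutOut.
Variables (sigma tau : cone) (u0 : MZ).
Hypotheses (hs : Sigma sigma) (hu0 : Gamma sigma u0).
Hypothesis tauE : tau = sigma `&` [set nu | pairing nu (toR R u0) = 0].

Lemma cut_face : face tau sigma.
Proof. by exists (toR R u0) => //; exact: Gamma_dual. Qed.

Lemma cut_cone : Sigma tau.
Proof. exact: triple_face cut_face. Qed.

Lemma cut_unit : Gamma tau (- u0).
Proof.
apply: (face_lattice_sub hs cut_face); apply: face_latticeN.
by apply: sub_group_gen; split=> //; rewrite tauE => nu [].
Qed.

Lemma cut_localization w : Gamma tau w -> exists K, Gamma sigma (w + u0 *+ K).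
Proof.
pose D : set MZ := [set l | (exists K, Gamma sigma (l + u0 *+ K)) /\
                            (exists K, Gamma sigma (- l + u0 *+ K))].
have D_subgroup : subgroup_set D.
  split=> [|l l' [[K1 h1] [K2 h2]] [[K1' h1'] [K2' h2']]|l [hK hK']].
  - by split; exists 0%N; rewrite ?oppr0 mulr0n addr0; exact: Gamma0.
  - split; [exists (K1 + K1')%N|exists (K2 + K2')%N].
      by rewrite mulrnDr addrACA; exact: GammaD.
    by rewrite opprD mulrnDr addrACA; exact: GammaD.
  - by split; rewrite ?opprK.
have [n [a [sa sE]]] := rational_cone_gen (triple_rational hs).
have D_gen : Gamma sigma `&` [set v | forall nu, tau nu -> pairing nu (toR R v) = 0]
    `<=` D.
  move=> v [sv tv]; split; first by exists 0%N; rewrite mulr0n addr0.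
  pose N := (\sum_i `|dot (a i) v|)%N.
  have dN : dual_cone sigma (toR R (u0 *+ N - v)).
    move=> _ /sE[c c0 ->]; rewrite pairing_sumZl; apply: sumr_ge0 => i _.
    rewrite mulr_ge0// pairing_int ler0z linearB linearMn /= subr_ge0.
    have := Gamma_ge0 hs hu0 (sa i); rewrite pairing_int ler0z.
    rewrite le_eqVlt => /orP[/eqP u00|u0_gt0].
      have : dot (a i) v = 0.
        apply/eqP; rewrite -(intr_eq0 R) -pairing_int; apply/eqP; apply: tv.
        by rewrite tauE; split=> //=; rewrite pairing_int -u00.
      by move=> ->; rewrite -u00 mul0rn.
    have : `|dot (a i) v|%N%:Z <= N%:Z.
      by rewrite lez_nat /N (bigD1 i)//= leq_addr.
    have : N%:Z <= dot (a i) u0 *+ N by rewrite -mulr_natl natz ler_peMr// -gtz0_ge1.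
    move: (dot (a i) v) (dot (a i) u0 *+ N) => p q; lia.
  have [N' N'0 hN'] := Gamma_multiple hs dN.
  exists (N * N')%N.
  have -> : - v + u0 *+ (N * N') = (u0 *+ N - v) *+ N' + v *+ N'.-1.
    case: N' N'0 {hN'} => // N' _ /=.
    by rewrite mulrnBl -mulrnA [in RHS]mulrS opprD addrCA -addrA subrK.
  apply: GammaD => //; apply: semigroupMn => //; [exact: Gamma0|exact: GammaD].
rewrite (Gamma_face hs cut_face) => -[v sv [l tl <-]].
have [[K hK] _] := group_gen_min D_subgroup D_gen tl.
by exists K; rewrite -addrA; exact: GammaD.
Qed.

Variable k : fieldType.
Implicit Types x z : MZ -> k.

Lemma cut_point_neq0 z : toric_points (Gamma tau) z -> z u0 != 0.
Proof.
move=> Tz; apply: (toric_point_unit Tz _ cut_unit).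
exact: (Gamma_sub hs cut_face).
Qed.

Lemma cut_pointE z w K : toric_points (Gamma tau) z -> Gamma tau w ->
  z w = z (w + u0 *+ K) / z u0 ^+ K.
Proof.
move=> Tz hw; have hu := Gamma_sub hs cut_face hu0.
have [_ zD _] := Tz.
rewrite zD//; last by apply: semigroupMn => //;
  [exact: Gamma0 cut_cone|exact: GammaD cut_cone].
rewrite (toric_pointMn (Gamma0 cut_cone) (GammaD cut_cone) K Tz hu).
by rewrite mulfK// expf_neq0// cut_point_neq0.
Qed.

Lemma cut_restrict_inj z z' : toric_points (Gamma tau) z ->
  toric_points (Gamma tau) z' ->
  restrict_point (Gamma sigma) z = restrict_point (Gamma sigma) z' -> z = z'.
Proof.
move=> Tz Tz' e; have zz' u : Gamma sigma u -> z u = z' u.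
  by move=> su; rewrite -(restrict_pointE z su) e restrict_pointE.
apply: (toric_points_ext Tz Tz') => w hw.
have [K hK] := cut_localization hw.
by rewrite (cut_pointE K Tz hw) (cut_pointE K Tz' hw) !zz'.
Qed.

Lemma cut_extension x : toric_points (Gamma sigma) x -> x u0 != 0 ->
  exists2 z, toric_points (Gamma tau) z & x = restrict_point (Gamma sigma) z.
Proof.
move=> Tx xu0; have [x0 xD x_out] := Tx.
have /choice[K hK] : forall w, exists K, Gamma tau w -> Gamma sigma (w + u0 *+ K).
  move=> w; have [/cut_localization[K hK]|hw] := pselect (Gamma tau w).
    by exists K.
  by exists 0%N.
have xMn n : x (u0 *+ n) = x u0 ^+ n.
  by apply: (toric_pointMn (Gamma0 hs) (GammaD hs) n Tx).
have hMn n : Gamma sigma (u0 *+ n).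
  by apply: semigroupMn; [exact: Gamma0|exact: GammaD|].
pose z w := if w \in Gamma tau then x (w + u0 *+ K w) / x u0 ^+ K w else 0.
have zE w n : Gamma tau w -> Gamma sigma (w + u0 *+ n) ->
    z w = x (w + u0 *+ n) / x u0 ^+ n.
  move=> hw hn; rewrite /z mem_set//; apply/eqP.
  rewrite eqr_div ?expf_neq0// -!xMn -!xD//; last exact: hK.
  by rewrite addrAC.
have ts := Gamma_sub hs cut_face.
exists z; last first.
  apply/funext => u; have [su|su] := pselect (Gamma sigma u).
    rewrite restrict_pointE// (@zE u 0)//; first by rewrite mulr0n addr0 divr1.
      exact: ts.
    by rewrite mulr0n addr0.
  by rewrite restrict_point_out// x_out.
split=> [|v w hv hw|w hw]; last by rewrite /z memNset.
  rewrite (@zE 0 0) ?mulr0n ?addr0 ?x0 ?divr1//.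
    exact: Gamma0 cut_cone.
  exact: Gamma0.
have hvw := GammaD cut_cone hv hw.
have e : v + w + u0 *+ (K v + K w) = (v + u0 *+ K v) + (w + u0 *+ K w).
  by rewrite mulrnDr addrACA.
rewrite (@zE _ (K v + K w)%N)// e; last by apply: GammaD => //; exact: hK.
rewrite xD; [|exact: hK|exact: hK].
by rewrite (zE v (K v)) ?(zE w (K w))//; try exact: hK; rewrite exprD mulf_div.
Qed.

End FaceCutOut.

End ToricTriple.

(** * Complete fans *)

Lemma small_perturbation (R : realFieldType) (s : seq (R * R)) :
  (forall p, p \in s -> p.2 != 0) ->
  exists2 delta, 0 < delta & forall eps, 0 < eps <= delta ->
    forall p, p \in s -> p.1 + eps * p.2 != 0 /\ (p.1 < 0 -> p.1 + eps * p.2 < 0).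
Proof.
elim: s => [|[a b] s IHs] hs; first by exists 1.
have [p ps|delta delta0 hdelta] := IHs; first by apply: hs; rewrite inE ps orbT.
have b0 : b != 0 by apply: (hs (a, b)); rewrite mem_head.
have nb0 : 0 < `|b| by rewrite normr_gt0.
pose del := if a == 0 then 1 else `|a| / (`|b| * 2).
have del0 : 0 < del.
  by rewrite /del; case: eqVneq => // a0; rewrite divr_gt0 ?normr_gt0// mulr_gt0.
exists (Num.min delta del); first by rewrite lt_min delta0.
move=> eps; rewrite le_min => /and3P[eps0 e1 e2] p; rewrite inE => /orP[/eqP ->|]; last first.
  by apply: hdelta; rewrite eps0.
move: e2; rewrite /= /del; case: eqVneq => [-> _|a0 e2].
  by split; [rewrite add0r mulf_neq0// gt_eqF|rewrite ltxx].
have lt_ab : `|eps * b| < `|a|.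
  rewrite normrM gtr0_norm//; move: e2; rewrite ler_pdivlMr ?mulr_gt0// => e2.
  have : 0 < `|a| by rewrite normr_gt0.
  by nra.
split; last by move=> an; move: lt_ab; rewrite (ltr0_norm an) ltr_norml => /andP[]; lra.
apply: contraTneq lt_ab => /eqP; rewrite addr_eq0 => /eqP ->.
by rewrite normrN ltxx.
Qed.

Section CompleteFan.
Variables (R : realType) (d : nat).
Local Notation MZ := 'rV[int]_d.
Local Notation VR := 'rV[R]_d.
Local Notation cone := (set VR).
Variables (Sigma : set cone) (Gamma : cone -> set MZ).
Hypothesis hT : toric_triple Sigma Gamma.
Hypothesis hcomplete : fan_support Sigma = setT.
Implicit Types (sigma tau rho : cone) (nu : VR) (u v w : MZ).

(* A point outside the full-dimensional cones would remain outside of them after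
   a small generic perturbation, which also leaves the other cones. *)
Lemma full_cones_cover nu : exists sigma,
  [/\ Sigma sigma, cone_dim sigma d & sigma nu].
Proof.
apply: contrapT => noS.
have /choice[x hx] : forall sigma, exists x : VR, Sigma sigma -> x != 0 /\
    ((dual_cone sigma x /\ pairing nu x < 0) \/
     (forall mu, sigma mu -> pairing mu x = 0)).
  move=> sigma; have [hs|] := pselect (Sigma sigma); last by exists 0.
  have [full|[x x0 hx]] := full_cone_or_orthogonal sigma; last first.
    by exists x => _; split=> //; right.
  have : ~ forall x, dual_cone sigma x -> 0 <= pairing nu x.
    by move=> /(cone_bidual (triple_rational hT hs)) snu; apply: noS; exists sigma.
  move=> /existsNP[x /not_implyP[dx /negP]]; rewrite -ltNge => nux.
  exists x => _; split; last by left.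
  by apply: contraTneq nux => ->; rewrite pairing_dot linear0 ltxx.
have /finite_seqP[s sE] : finite_set Sigma by case: hT => -[].
have [e he] := avoid_hyperplanes [seq x sigma | sigma <- s].
have [p|delta delta0 hdelta] :=
    @small_perturbation R [seq (dot nu (x sigma), dot e (x sigma)) | sigma <- s].
  move=> /mapP[sigma ss ->] /=; apply: he; first exact: map_f.
  by apply: (hx sigma _).1; rewrite sE.
have : fan_support Sigma (nu + delta *: e) by rewrite hcomplete.
move=> [sigma hs snue]; have ss : sigma \in s by move: hs; rewrite sE.
have [] := hdelta delta _ (dot nu (x sigma), dot e (x sigma)).
- by rewrite delta0 lexx.
- by apply/mapP; exists sigma.
rewrite /= -dotZl -dotDl -pairing_dot => n0 neg.
have [_ [[dx nux]|ox]] := hx sigma hs; last by rewrite ox// eqxx in n0.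
by have := dx _ snue; rewrite leNgt neg.
Qed.

Lemma full_coface tau : Sigma tau ->
  exists sigma, [/\ Sigma sigma, cone_dim sigma d & face tau sigma].
Proof.
move=> ht; have [w tw wE] := cone_interior_point (triple_rational hT ht).
have [sigma [hs full sw]] := full_cones_cover w.
exists sigma; split=> //; apply: (triple_subface hT) => // nu tnu.
have [x dx tsE] := triple_faceI hT ht hs.
have wx : pairing w x = 0.
  by have : (tau `&` sigma) w by []; rewrite tsE => -[].
suff : (tau `&` sigma) nu by case.
by rewrite tsE; split=> //=; exact: wE.
Qed.

Lemma cone_0 sigma : Sigma sigma -> sigma 0.
Proof.
move=> /(triple_rational hT)/rational_cone_gen[n [a [sa sE]]]; apply/sE.
by exists (fun=> 0) => //; rewrite big1// => i _; rewrite scale0r.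
Qed.

Lemma face_set0 sigma : Sigma sigma -> face [set 0] sigma.
Proof.
move=> hs; have [[A [/finite_seqP[s ->] GE]] _] :
    fin_gen_semigroup (Gamma sigma) /\ True by case: hT => _ /(_ _ hs)[].
have Gs v : v \in s -> Gamma sigma v.
  by move=> vs; rewrite GE; apply: sub_semigroup_gen; left.
have G0 := Gamma0 hT hs; have GD := GammaD hT hs.
pose u := \sum_(i < size s) s`_i.
have hu : Gamma sigma u.
  by apply: semigroup_sum => // i _; apply: Gs; exact: mem_nth.
exists (toR R u); first exact: (Gamma_dual hT).
apply/seteqP; split=> nu /= => [->|[snu]].
  by split; [exact: cone_0|rewrite pairing_dot dotC linear0].
rewrite /u /toR raddf_sum pairing_dot linear_sum => /eqP.
rewrite psumr_eq0 => [/allP h|i _]; last first.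
  by apply: (Gamma_ge0 hT hs _ snu); apply: Gs; exact: mem_nth.
have hs0 v : v \in s -> pairing nu (toR R v) = 0.
  move=> vs; have := h (Ordinal (etrans (index_mem v s) vs)) (mem_index_enum _).
  by rewrite /= nth_index// => /eqP.
pose Z := [set v : MZ | pairing nu (toR R v) = 0].
have ZD : add_closed_set Z.
  by move=> v v' zv zv'; rewrite /Z /= pairingDr zv zv' addr0.
have Zall v : Z v.
  have : group_gen (Gamma sigma) v by rewrite (Gamma_group hT hs).
  have ZG : subgroup_set Z.
    split=> // [|v' zv]; first exact: pairing0r.
    by rewrite /Z /= pairingNr zv oppr0.
  apply: (group_gen_min ZG); rewrite GE; apply: semigroup_gen_min => // v' [/hs0//|->].
  exact: pairing0r.
apply/rowP => i; rewrite mxE -(dot_delta nu).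
have -> : delta_mx ord0 i = toR R (delta_mx ord0 i).
  by apply/rowP => j; rewrite !mxE; case: (_ && _).
exact: Zall.
Qed.

Lemma zero_cone : Sigma [set 0].
Proof.
have [sigma [hs _ _]] := full_cones_cover 0.
exact: (triple_face hT hs (face_set0 hs)).
Qed.

Lemma Gamma_zero_cone : Gamma [set 0] = setT.
Proof.
have [sigma [hs _ _]] := full_cones_cover 0.
apply/seteqP; split=> // u _; apply: (face_lattice_sub hT hs (face_set0 hs)).
rewrite /face_lattice.
have -> : Gamma sigma `&` [set v | forall nu, [set 0] nu -> pairing nu (toR R v) = 0]
    = Gamma sigma.
  apply/seteqP; split=> [v []//|v hv]; split=> // nu ->.
  by rewrite pairing_dot dotC linear0.
by rewrite (Gamma_group hT hs).
Qed.

Section FullCone.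
Variable sigma : cone.
Hypotheses (hs : Sigma sigma) (full : cone_dim sigma d).

Lemma full_Gamma_unit u : Gamma sigma u -> Gamma sigma (- u) -> u = 0.
Proof.
move=> su sNu; apply: (@toR_eq0 R); apply: (full_cone_span full) => nu snu.
apply/eqP; rewrite eq_le (Gamma_ge0 hT hs su snu) andbT -oppr_ge0 -pairingNr.
exact: (Gamma_ge0 hT hs sNu snu).
Qed.

Lemma full_interior_gt0 : exists w : VR, forall u, Gamma sigma u -> u != 0 ->
  0 < pairing w (toR R u).
Proof.
have [w sw wE] := cone_interior_point (triple_rational hT hs).
exists w => u su u0; rewrite lt_neqAle (Gamma_ge0 hT hs su sw) andbT eq_sym.
apply: contraNneq u0 => /wE h; apply/eqP/(@toR_eq0 R)/(full_cone_span full).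
by apply: h; exact: (Gamma_dual hT).
Qed.

Variable k : fieldType.

Definition fixed_point : MZ -> k := fun u => (u == 0)%:R.

Lemma toric_fixed_point : toric_points (Gamma sigma) fixed_point.
Proof.
split=> [|u v su sv|u su]; rewrite /fixed_point ?eqxx//; last first.
  by case: eqVneq su => // ->; have := Gamma0 hT hs.
have [->|u0] := eqVneq u 0; first by rewrite add0r mul1r.
rewrite mul0r; case: eqVneq => // uv0; case/eqP: u0.
by apply: full_Gamma_unit => //; rewrite (addr0_eq uv0).
Qed.

(* Lowest terms with respect to a functional that is positive on
   [Gamma sigma]. *)
Lemma full_saturation (F Q P : seq (k * MZ)) :
  (forall p, p \in Q -> Gamma sigma p.2) -> (forall p, p \in P -> Gamma sigma p.2) ->
  (forall v, \sum_(a <- F) \sum_(b <- Q | a.2 + b.2 == v) a.1 * b.1 =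
             \sum_(p <- P | p.2 == v) p.1) ->
  \sum_(b <- Q) b.1 * fixed_point b.2 != 0 ->
  forall v, \sum_(a <- F | a.2 == v) a.1 != 0 -> Gamma sigma v.
Proof.
move=> hQ hP FQP Q0 v0 Fv0; apply: contrapT => sv0.
have [w hw] := full_interior_gt0.
pose coefF v := \sum_(a <- F | a.2 == v) a.1.
pose bad v := (coefF v != 0) && ~~ `[< Gamma sigma v >].
have badF v : bad v -> v \in [seq a.2 | a <- F].
  move=> /andP[Fv _]; apply: contraNT Fv => vF; rewrite /coefF big_seq_cond big1//.
  by move=> a /andP[aF /eqP av]; rewrite -av map_f in vF.
have bad0 : bad v0 by rewrite /bad Fv0; apply/asboolPn.
pose B := [seq v <- [seq a.2 | a <- F] | bad v].
have v0B : v0 \in B by rewrite mem_filter bad0 badF.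
pose f (i : 'I_(size B)) := pairing w (toR R B`_i).
have i0 : 'I_(size B) by apply: (Ordinal (etrans (index_mem v0 B) v0B)).
case: (@arg_minP _ _ _ i0 predT f isT) => i _ min.
set v := B`_i in min; have : v \in B by exact: mem_nth.
rewrite mem_filter => /andP[/andP[Fv /asboolPn sv] _].
have minB v' : bad v' -> pairing w (toR R v) <= pairing w (toR R v').
  move=> bv'; have v'B : v' \in B by rewrite mem_filter bv' badF.
  have := min (Ordinal (etrans (index_mem v' B) v'B)) isT.
  by rewrite /f /= nth_index.
have := FQP v; rewrite [RHS]big_seq_cond [RHS]big1; last first.
  by move=> p /andP[/hP sp /eqP pv]; rewrite pv in sp.
under eq_bigr do rewrite big_mkcond.
rewrite exchange_big /= big_seq (eq_bigr (fun b => b.1 * fixed_point b.2 * coefF v)).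
  rewrite -big_seq -mulr_suml => /eqP.
  by rewrite mulf_eq0 (negPf Q0) (negPf Fv).
move=> b /hQ sb; rewrite -big_mkcond -mulr_suml /=.
have -> : \sum_(a <- F | a.2 + b.2 == v) a.1 = coefF (v - b.2).
  by apply: eq_bigl => a; rewrite eq_sym -subr_eq eq_sym.
rewrite /fixed_point; have [->|b0] := eqVneq b.2 0.
  by rewrite subr0 mulr1 mulrC.
rewrite mulr0 mul0r; apply/eqP; rewrite mulf_eq0; apply/orP; left.
apply/negPn/negP => Fvb.
have /minB : bad (v - b.2).
  rewrite /bad Fvb; apply/asboolPn => svb; apply: sv.
  by rewrite -(subrK b.2 v); exact: (GammaD hT).
by rewrite pairingBr lerBDr gerDl leNgt hw.
Qed.

End FullCone.

End CompleteFan.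

(** * Glueing *)

Section Glueing.
Variables (R : realType) (k : fieldType) (d : nat).
Local Notation MZ := 'rV[int]_d.
Local Notation VR := 'rV[R]_d.
Local Notation cone := (set VR).
Variables (Sigma : set cone) (Gamma : cone -> set MZ).
Hypothesis hT : toric_triple Sigma Gamma.
Implicit Types (sigma tau rho : cone) (u v w : MZ) (x y z : MZ -> k).
Local Notation pt sigma := (@toric_points k MZ (Gamma sigma)).
Local Notation glued := (@toric_glue R k d Gamma).
Local Notation chart := (@toric_chart R k d Sigma Gamma).

Lemma toric_points_face sigma tau z : Sigma sigma -> face tau sigma ->
  pt tau z -> pt sigma (restrict_point (Gamma sigma) z).
Proof.
move=> hs ts; apply: toric_points_restrict.
- exact: (Gamma_sub hT).
- exact: (Gamma0 hT).
- exact: (GammaD hT).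
Qed.

Lemma glue_refl sigma x : pt sigma x -> glued (sigma, x) (sigma, x).
Proof.
by move=> Tx; exists x; rewrite /= ?setIid// restrict_point_id.
Qed.

Lemma glue_sym p q : glued p q -> glued q p.
Proof. by move=> [y Ty [e1 e2]]; exists y => //; rewrite setIC. Qed.

Lemma glue_trans p q r : Sigma p.1 -> Sigma q.1 -> Sigma r.1 ->
  glued p q -> glued q r -> glued p r.
Proof.
case: p q r => [s1 x1] [s2 x2] [s3 x3] /= h1 h2 h3.
move=> [y /= Ty [x1E x2E]] [z /= Tz [x2E' x3E]].
have [u1 hu1 u1E] := face_integral hT h2 (triple_faceI hT h2 h1).
have [u2 hu2 u2E] := face_integral hT h2 (triple_faceI hT h2 h3).
rewrite setIC in u1E.
pose t1 := s1 `&` s2; pose t2 := s2 `&` s3; pose rho := t1 `&` t2.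
have ht1 : Sigma t1 by exact: (triple_coneI hT).
have ht2 : Sigma t2 by exact: (triple_coneI hT).
have hrho : Sigma rho by exact: (triple_coneI hT).
have hu12 : Gamma s2 (u1 + u2) by exact: (GammaD hT).
have rhoE : rho = s2 `&` [set nu | pairing nu (toR R (u1 + u2)) = 0].
  rewrite /rho /t1 /t2 u1E u2E; apply/seteqP; split=> nu /=.
    by move=> [[? n1] [s2nu n2]]; rewrite pairingDr n1 n2 addr0.
  move=> [s2nu]; rewrite pairingDr => /eqP.
  rewrite paddr_eq0; [|exact: (Gamma_ge0 hT h2 hu1)|exact: (Gamma_ge0 hT h2 hu2)].
  by move=> /andP[/eqP n1 /eqP n2].
have Tx2 : pt s2 x2.
  by rewrite x2E'; apply: toric_points_face Tz => //; exact: (triple_faceI hT).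
have x2u : x2 (u1 + u2) != 0.
  have [_ -> //] := Tx2; rewrite mulf_neq0//.
    by rewrite x2E restrict_pointE//; exact: (cut_point_neq0 hT h2 hu1 u1E).
  by rewrite x2E' restrict_pointE//; exact: (cut_point_neq0 hT h2 hu2 u2E).
have [w Tw x2w] := cut_extension hT h2 hu12 rhoE Tx2 x2u.
have rho1 : face rho t1 by apply: (triple_subface hT) => // nu [].
have rho2 : face rho t2 by apply: (triple_subface hT) => // nu [].
have rho3 : face rho (s1 `&` s3).
  apply: (triple_subface hT) => //; first exact: (triple_coneI hT).
  by move=> nu [[? ?] [? ?]].
have sub a b : Sigma a -> Sigma b -> Gamma a `<=` Gamma (a `&` b).
  by move=> ha hb; apply: (Gamma_sub hT ha); exact: (triple_faceI hT).
have yE : restrict_point (Gamma t1) w = y.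
  apply: (cut_restrict_inj hT h2 hu1 u1E) => //; first exact: toric_points_face Tw.
  by rewrite -x2E restrict_restrict ?x2w// /t1 setIC; exact: sub.
have zE : restrict_point (Gamma t2) w = z.
  apply: (cut_restrict_inj hT h2 hu2 u2E) => //; first exact: toric_points_face Tw.
  by rewrite -x2E' restrict_restrict ?x2w//; exact: sub.
exists (restrict_point (Gamma (s1 `&` s3)) w) => /=.
  by apply: toric_points_face Tw => //; exact: (triple_coneI hT).
split.
  by rewrite restrict_restrict ?x1E -?yE ?restrict_restrict//; exact: sub.
rewrite restrict_restrict ?x3E -?zE ?restrict_restrict// /t2 setIC; exact: sub.
Qed.

Lemma chart_eqP sigma x sigma' x' : Sigma sigma -> Sigma sigma' ->
  pt sigma x -> pt sigma' x' ->
  chart sigma x = chart sigma' x' <-> glued (sigma, x) (sigma', x').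
Proof.
move=> hs hs' Tx Tx'; split=> [e|e].
  have : chart sigma' x' (sigma', x') by split=> //; exact: glue_refl.
  by rewrite -e => -[].
apply/seteqP; split=> -[s y] [/= hy Ty ey]; split=> //.
  by apply: (@glue_trans _ (sigma, x)) ey => //; exact: glue_sym.
exact: (@glue_trans _ (sigma', x')) ey.
Qed.

Lemma chart_face sigma tau z : Sigma sigma -> face tau sigma -> pt tau z ->
  chart tau z = chart sigma (restrict_point (Gamma sigma) z).
Proof.
move=> hs ts Tz; have ht := triple_face hT hs ts.
apply/chart_eqP => //; first exact: toric_points_face Tz.
exists z; first by rewrite /= (setIidl (face_sub ts)).
by rewrite /= restrict_point_id.
Qed.

Lemma points_chart sigma x : Sigma sigma -> pt sigma x ->
  points (toric_variety k Sigma Gamma) (chart sigma x).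
Proof. by move=> hs Tx; exists sigma, x. Qed.

Lemma chart_overlap sigma sigma' u y : Sigma sigma -> Sigma sigma' ->
  Gamma sigma' u -> sigma `&` sigma' = sigma' `&` [set nu | pairing nu (toR R u) = 0] ->
  pt sigma' y -> y u != 0 ->
  exists2 z, pt (sigma `&` sigma') z & y = restrict_point (Gamma sigma') z /\
    chart sigma' y = chart sigma (restrict_point (Gamma sigma) z).
Proof.
move=> hs hs' hu uE Ty yu; have [z Tz yE] := cut_extension hT hs' hu uE Ty yu.
exists z => //; split=> //.
have Tx : pt sigma (restrict_point (Gamma sigma) z).
  by apply: toric_points_face Tz => //; exact: (triple_faceI hT).
apply/chart_eqP => //; apply: glue_sym.
by exists z.
Qed.

Hypothesis hcomplete : fan_support Sigma = setT.

Lemma points_full_chart c : points (toric_variety k Sigma Gamma) c ->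
  exists sigma x, [/\ Sigma sigma, cone_dim sigma d, pt sigma x &
                      c = chart sigma x].
Proof.
move=> [tau [z [ht Tz ->]]].
have [sigma [hs full ts]] := full_coface hT hcomplete ht.
exists sigma, (restrict_point (Gamma sigma) z); split=> //.
  exact: toric_points_face Tz.
exact: chart_face.
Qed.

End Glueing.

Section SupportFunction.
Variables (R : realType) (d : nat).
Local Notation MZ := 'rV[int]_d.
Local Notation VR := 'rV[R]_d.
Local Notation cone := (set VR).
Variables (Sigma : set cone) (Gamma : cone -> set MZ).
Variables (h : VR -> R) (m : cone -> MZ).
Hypothesis hT : toric_triple Sigma Gamma.
Hypothesis hcomplete : fan_support Sigma = setT.
Hypothesis hSF : support_function Sigma Gamma h m.
Implicit Types (sigma tau : cone) (u : MZ).

Lemma support_functionE sigma nu : Sigma sigma -> sigma nu ->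
  h nu = pairing nu (toR R (m sigma)).
Proof. by case: hSF => _ + _; apply. Qed.

Lemma transition_unit sigma tau : Sigma sigma -> face tau sigma ->
  Gamma tau (m tau - m sigma) /\ Gamma tau (m sigma - m tau).
Proof.
move=> hs ts; have ht := triple_face hT hs ts.
have hm : face_lattice tau (Gamma tau) (m tau - m sigma) by case: hSF => _ _; apply.
split; apply: (face_lattice_sub hT ht (face_refl tau)) => //.
by rewrite -opprB; exact: face_latticeN.
Qed.

Lemma transition_unitI sigma sigma' : Sigma sigma -> Sigma sigma' ->
  Gamma (sigma `&` sigma') (m sigma' - m sigma).
Proof.
move=> hs hs'; rewrite -(subrKA (m (sigma `&` sigma'))).
have [_ h1] := transition_unit hs' (triple_faceI hT hs' hs).
have [h2 _] := transition_unit hs (triple_faceI hT hs hs').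
by rewrite setIC in h1; apply: (GammaD hT) => //; exact: (triple_coneI hT).
Qed.

Lemma section_exponent_ge u nu : section_exponents Sigma Gamma m u ->
  h nu <= pairing nu (toR R u).
Proof.
move=> hu; have [sigma [hs _ snu]] := full_cones_cover hT hcomplete nu.
rewrite (support_functionE hs snu) -subr_ge0 -pairingBr.
exact: (Gamma_ge0 hT hs (hu _ hs) snu).
Qed.

Lemma section_exponents_full u :
  (forall sigma, Sigma sigma -> cone_dim sigma d -> Gamma sigma (u - m sigma)) ->
  section_exponents Sigma Gamma m u.
Proof.
move=> hu tau ht; have [sigma [hs full ts]] := full_coface hT hcomplete ht.
rewrite -(subrKA (m sigma)); apply: (GammaD hT ht).
  by apply: (Gamma_sub hT hs ts); exact: hu.
by case: (transition_unit hs ts).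
Qed.

End SupportFunction.

(** * Global sections *)

Section TorusCoefficients.
Variables (k : closedFieldType) (d : nat).
Local Notation MZ := 'rV[int]_d.
Local Notation torus := (@toric_points k MZ setT).

Lemma torus_mul_coef (A B P : seq (k * MZ)) :
  (forall x, torus x -> (\sum_(a <- A) a.1 * x a.2) * (\sum_(b <- B) b.1 * x b.2) =
     \sum_(p <- P) p.1 * x p.2) ->
  forall v, \sum_(a <- A) \sum_(b <- B | a.2 + b.2 == v) a.1 * b.1 =
            \sum_(p <- P | p.2 == v) p.1.
Proof.
move=> ABP v.
pose S := [seq (a.1 * b.1, a.2 + b.2) | a <- A, b <- B] ++ [seq (- p.1, p.2) | p <- P].
have /torus_coef/(_ v) : forall x, torus x -> \sum_(p <- S) p.1 * x p.2 = 0.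
  move=> x Tx; rewrite big_cat big_flatten !big_map /=.
  under [X in _ + X]eq_bigr do rewrite mulNr.
  rewrite sumrN -ABP// mulr_suml; apply/eqP; rewrite subr_eq0; apply/eqP.
  apply: eq_bigr => a _; rewrite big_map mulr_sumr; apply: eq_bigr => b _ /=.
  by rewrite torusD// mulrACA.
rewrite big_cat big_flatten !big_map /= sumrN => /eqP.
rewrite subr_eq0 => /eqP <-; apply: eq_bigr => a _.
by rewrite big_map.
Qed.

Lemma toric_fun_torus_eq0 (L : set MZ) f : L 0 -> add_closed_set L ->
  toric_fun L f -> (forall x, torus x -> f (restrict_point L x) = 0) ->
  forall x, toric_points L x -> f x = 0.
Proof.
move=> L0 LD [S [hS hf]] f0 x Tx; rewrite hf//.
apply: torus_sum_eq0 => y Ty; rewrite -[RHS](f0 y Ty) hf; last first.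
  exact: (toric_points_restrict (fun _ _ => I)) Ty.
rewrite big_seq [RHS]big_seq; apply: eq_bigr => p /hS Lp.
by rewrite restrict_pointE.
Qed.

End TorusCoefficients.

Section GlobalSections.
Variables (R : realType) (k : closedFieldType) (d : nat).
Local Notation MZ := 'rV[int]_d.
Local Notation VR := 'rV[R]_d.
Local Notation cone := (set VR).
Variables (Sigma : set cone) (Gamma : cone -> set MZ).
Variables (h : VR -> R) (m : cone -> MZ).
Hypothesis hT : toric_triple Sigma Gamma.
Hypothesis hcomplete : fan_support Sigma = setT.
Hypothesis hSF : support_function Sigma Gamma h m.
Local Notation pt sigma := (@toric_points k MZ (Gamma sigma)).
Local Notation torus := (@toric_points k MZ setT).
Implicit Types (sigma tau : cone) (u : MZ) (x y : MZ -> k).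

Lemma global_section_monomial u : section_exponents Sigma Gamma m u ->
  global_section Sigma Gamma m (fun sigma (x : MZ -> k) => x (u - m sigma)).
Proof.
move=> hu; split=> [sigma hs|sigma sigma' y hs hs' Ty].
  apply/regular_onP => // x Tx.
  exists (fun y => y (u - m sigma)), (fun=> 1); split=> //.
  - by apply: toric_fun_monomial; exact: hu.
  - exact: toric_fun_cst (Gamma0 hT hs) _.
  - exact: oner_neq0.
  - by move=> y _ _; rewrite divr1.
rewrite !restrict_pointE; [|exact: hu|exact: hu].
have [_ yD _] := Ty; rewrite -yD.
- by rewrite [in RHS]addrC subrKA.
- exact: (transition_unitI hT hSF).
- have := hu _ hs'; rewrite setIC; apply: (Gamma_sub hT hs').
  exact: (triple_faceI hT).
Qed.

Lemma global_section_sum (s : cone -> (MZ -> k) -> k) :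
  global_section Sigma Gamma m s ->
  exists S : seq (k * MZ),
    (forall p, p \in S -> section_exponents Sigma Gamma m p.2) /\
    forall sigma x, Sigma sigma -> pt sigma x ->
      s sigma x = \sum_(p <- S) p.1 * x (p.2 - m sigma).
Proof.
move=> [s_reg s_glue]; have h0 := zero_cone hT hcomplete.
have G0 := Gamma_zero_cone hT hcomplete.
pose z : cone := [set 0]; rewrite -/z in h0 G0.
have [S0 [_ hS0]] : toric_fun setT (s z).
  apply: torus_regular_toric => x Tx.
  have /regular_onP : regular_on (affine_toric k (Gamma z)) (pt z) (s z) by exact: s_reg.
  by rewrite G0; apply.
pose S1 := [seq (p.1, p.2 + m z) | p <- S0].
have torusE sigma x : Sigma sigma -> torus x ->
    s sigma (restrict_point (Gamma sigma) x) = \sum_(p <- S1) p.1 * x (p.2 - m sigma).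
  move=> hs Tx; have zs : sigma `&` z = z.
    by apply: setIidr => nu ->; exact: (cone_0 hT).
  have := s_glue sigma z x hs h0; rewrite zs G0 => -> //.
  rewrite restrict_point_id// hS0// mulr_sumr big_map; apply: eq_bigr => p _ /=.
  by rewrite mulrCA -torusD//; congr (_ * x _); rewrite addrC addrA.
pose coef v := \sum_(p <- S1 | p.2 == v) p.1.
have hcoef v : coef v != 0 -> section_exponents Sigma Gamma m v.
  move=> cv; apply: (section_exponents_full hT hcomplete hSF) => sigma hs full.
  have GS0 := Gamma0 hT hs; have GSD := GammaD hT hs.
  have Tfix := toric_fixed_point hT hs full k.
  have /regular_onP reg := s_reg sigma hs.
  have [//|f [g [hf hg gx fg]]] := reg _ _ Tfix.
  have [P [hP PE]] := toric_funM GSD hf hg.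
  have [Q [hQ QE]] := toric_funM GSD hg hg.
  pose F := [seq (p.1, p.2 - m sigma) | p <- S1].
  apply: (@full_saturation _ _ _ _ hT sigma hs full k F Q P hQ hP).
  - apply: torus_mul_coef => x Tx.
    have Tr : pt sigma (restrict_point (Gamma sigma) x).
      exact: (toric_points_restrict (fun _ _ => I)) Tx.
    have resE S : (forall p : k * MZ, p \in S -> Gamma sigma p.2) ->
        \sum_(p <- S) p.1 * x p.2 = \sum_(p <- S) p.1 * restrict_point (Gamma sigma) x p.2.
      move=> hS; rewrite big_seq [RHS]big_seq; apply: eq_bigr => p /hS sp.
      by rewrite restrict_pointE.
    rewrite (resE Q)// (resE P)// -PE// -QE// big_map -torusE//.
    have [->|gr] := eqVneq (g (restrict_point (Gamma sigma) x)) 0.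
      by rewrite !mulr0.
    by rewrite fg//; field.
  - by rewrite -QE// mulf_neq0.
  - by rewrite big_map /=; under eq_bigl do rewrite (inj_eq (addIr _)).
pose S := [seq (coef v, v) | v <- undup [seq p.2 | p <- S1] & coef v != 0].
have SE F : \sum_(p <- S1) p.1 * F p.2 = \sum_(p <- S) p.1 * F p.2 :> k.
  rewrite group_terms big_map big_filter [RHS]big_mkcond; apply: eq_bigr => v _ /=.
  by case: eqVneq => //; rewrite -/(coef v) => ->; rewrite mul0r.
have hS p : p \in S -> section_exponents Sigma Gamma m p.2.
  by move=> /mapP[v]; rewrite mem_filter => /andP[/hcoef hv _] ->.
exists S; split=> // sigma x hs Tx.
have GS0 := Gamma0 hT hs; have GSD := GammaD hT hs.
have /regular_onP reg := s_reg sigma hs.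
have [//|f [g [hf hg gx fg]]] := reg _ _ Tx.
pose G y : k := \sum_(p <- S) p.1 * y (p.2 - m sigma).
have hG : toric_fun (Gamma sigma) G.
  exists [seq (p.1, p.2 - m sigma) | p <- S]; split=> [p /mapP[q /hS hq ->]|y Ty].
    exact: hq.
  by rewrite big_map.
have E0 y : pt sigma y -> (f y + -1 * (g y * G y)) * g y = 0.
  apply: (@toric_fun_torus_eq0 k d _ (fun y => (f y + -1 * (g y * G y)) * g y) GS0 GSD).
    apply: toric_funM => //; apply: toric_funD => //; apply: toric_funM => //.
      exact: toric_fun_cst.
    exact: toric_funM.
  move=> {}y Ty; have Tr : pt sigma (restrict_point (Gamma sigma) y).
    exact: (toric_points_restrict (fun _ _ => I)) Ty.
  set r := restrict_point _ y in Tr *.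
  have [->|gr] := eqVneq (g r) 0; first by rewrite mulr0.
  have -> : G r = f r / g r.
    rewrite -fg// torusE// (SE (fun v => y (v - m sigma))) /G big_seq [RHS]big_seq.
    by apply: eq_bigr => p /hS hp; rewrite /r restrict_pointE//; exact: hp.
  by field.
rewrite fg// -/(G x); have /eqP := E0 x Tx.
rewrite mulf_eq0 (negPf gx) orbF mulN1r subr_eq0 => /eqP ->.
by rewrite mulrC mulKf.
Qed.

End GlobalSections.

(** * Very ample divisors are strictly convex and generated *)

Lemma toric_fun_eval_row (k : fieldType) (M : zmodType) (L : set M) n e p
    (f : 'I_n -> (M -> k) -> k) : L 0 -> add_closed_set L -> homog_poly e p ->
  (forall j, toric_fun L (f j)) ->
  toric_fun L (fun x => eval_row p (\row_j f j x)).
Proof.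
move=> L0 LD /homog_polyE[r [c [a [_ pE]]]] hf.
apply: (@eq_toric_fun _ _ _ (fun x => \sum_(i <- enum 'I_r)
    c i * \prod_(j <- enum 'I_n) f j x ^+ a i j)).
  move=> x _; rewrite pE big_enum; apply: eq_bigr => i _; rewrite big_enum.
  by congr (_ * _); apply: eq_bigr => j _; rewrite mxE.
apply: toric_fun_sum => i; apply: toric_funM => //; first exact: toric_fun_cst.
by apply: toric_fun_prod => // j; apply: toric_funX.
Qed.

Section ChartCoordinates.
Variables (R : realType) (k : fieldType) (d : nat).
Local Notation MZ := 'rV[int]_d.
Local Notation VR := 'rV[R]_d.
Local Notation cone := (set VR).
Variables (Sigma : set cone) (Gamma : cone -> set MZ).
Hypothesis hT : toric_triple Sigma Gamma.
Implicit Types (sigma tau : cone) (u v : MZ) (x y z : MZ -> k).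
Local Notation pt sigma := (@toric_points k MZ (Gamma sigma)).
Local Notation chart := (@toric_chart R k d Sigma Gamma).
Local Notation X := (toric_variety k Sigma Gamma).

Lemma toric_regularP U f : regular_on X U f <-> forall sigma, Sigma sigma ->
  regular_on (affine_toric k (Gamma sigma))
    (pullback_set (affine_toric k (Gamma sigma)) (chart sigma) U) (f \o chart sigma).
Proof. by []. Qed.

Lemma toric_opensP U : opens X U <-> U `<=` points X /\
  forall sigma, Sigma sigma -> opens (affine_toric k (Gamma sigma))
    (pullback_set (affine_toric k (Gamma sigma)) (chart sigma) U).
Proof. by []. Qed.

Definition chart_coord sigma c : MZ -> k :=
  xget (fun=> 0) [set x | pt sigma x /\ c = chart sigma x].

Lemma chart_inj sigma x y : Sigma sigma -> pt sigma x -> pt sigma y ->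
  chart sigma x = chart sigma y -> x = y.
Proof.
by move=> hs Tx Ty /(chart_eqP hT hs hs Tx Ty)[z _ /= [-> ->]].
Qed.

Lemma chart_coordE sigma x : Sigma sigma -> pt sigma x ->
  chart_coord sigma (chart sigma x) = x.
Proof.
move=> hs Tx; rewrite /chart_coord; case: xgetP => [y _ [Ty e]|/(_ x)[]//].
exact: (@chart_inj sigma y x hs Ty Tx (esym e)).
Qed.

Definition chart_domain sigma : set (set (cone * (MZ -> k))) := chart sigma @` pt sigma.

Lemma chart_domain_cut sigma sigma' y : Sigma sigma -> Sigma sigma' ->
  pt sigma' y -> exists u,
  [/\ Gamma sigma' u,
      sigma `&` sigma' = sigma' `&` [set nu | pairing nu (toR R u) = 0] &
      chart_domain sigma (chart sigma' y) -> y u != 0].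
Proof.
move=> hs hs' Ty.
have [u hu uE] := face_integral hT hs' (triple_faceI hT hs' hs).
rewrite setIC in uE; exists u; split=> // -[x Tx /(chart_eqP hT hs hs' Tx Ty)].
move=> [z Tz /= [_ yE]]; rewrite yE restrict_pointE//.
exact: (cut_point_neq0 hT hs' hu uE).
Qed.

Lemma chart_domain_open sigma : Sigma sigma -> opens X (chart_domain sigma).
Proof.
move=> hs; apply/toric_opensP; split=> [_ [x Tx <-]|sigma' hs'].
  exact: points_chart.
apply/opensP; split=> [y []//|y [Ty dy]].
have [u [hu uE /(_ dy) yu]] := chart_domain_cut hs hs' Ty.
exists (fun y => y u); first exact: toric_fun_monomial.
split=> // y' Ty' y'u; split=> //.
have [z Tz [_ e]] := chart_overlap hT hs hs' hu uE Ty' y'u.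
rewrite /= e.
exists (restrict_point (Gamma sigma) z) => //.
by apply: (toric_points_face hT) Tz => //; exact: (triple_faceI hT).
Qed.

Lemma chart_monomial_regular sigma v : Sigma sigma -> Gamma sigma v ->
  regular_on X (chart_domain sigma) (fun c => chart_coord sigma c v).
Proof.
move=> hs hv; apply/toric_regularP => sigma' hs'; apply/regular_onP => [|y [Ty dy]].
  by move=> y [].
have [u [hu uE /(_ dy) yu]] := chart_domain_cut hs hs' Ty.
have hv' : Gamma (sigma `&` sigma') v.
  by apply: (Gamma_sub hT hs) => //; exact: (triple_faceI hT).
have [K hK] := cut_localization hT hs' hu uE hv'.
have GS0 := Gamma0 hT hs'; have GSD := GammaD hT hs'.
exists (fun y => y (v + u *+ K)), (fun y => y u ^+ K); split.
- exact: toric_fun_monomial.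
- by apply: toric_funX => //; exact: toric_fun_monomial.
- by rewrite expf_neq0.
move=> y' [Ty' dy'] _ /=.
have [x Tx e] := dy'; have /(chart_eqP hT hs hs' Tx Ty')[z Tz /= [xE yE]] := e.
rewrite -e chart_coordE// xE yE !restrict_pointE//.
exact: (cut_pointE hT hs' hu uE).
Qed.

End ChartCoordinates.

Section VeryAmpleImpliesConvex.
Variables (R : realType) (k : closedFieldType) (d : nat).
Local Notation MZ := 'rV[int]_d.
Local Notation VR := 'rV[R]_d.
Local Notation cone := (set VR).
Variables (Sigma : set cone) (Gamma : cone -> set MZ).
Variables (h : VR -> R) (m : cone -> MZ).
Hypothesis hT : toric_triple Sigma Gamma.
Hypothesis hcomplete : fan_support Sigma = setT.
Hypothesis hSF : support_function Sigma Gamma h m.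
Local Notation pt sigma := (@toric_points k MZ (Gamma sigma)).
Local Notation torus := (@toric_points k MZ setT).
Local Notation chart := (@toric_chart R k d Sigma Gamma).
Local Notation X := (toric_variety k Sigma Gamma).
Local Notation PD := (section_exponents Sigma Gamma m).
Local Notation differences sigma := [set u - m sigma | u in PD].
Implicit Types (sigma : cone) (u v : MZ) (x : MZ -> k).

Lemma differences_sub sigma : Sigma sigma ->
  semigroup_gen (differences sigma) `<=` Gamma sigma.
Proof.
move=> hs; apply: semigroup_gen_min; first exact: (GammaD hT).
by move=> _ [u hu <-]; exact: hu.
Qed.

Lemma upper_convex_of_vertices :
  (forall sigma, Sigma sigma -> cone_dim sigma d -> PD (m sigma)) ->
  upper_convex h.
Proof.
move=> hm nu nu'; have [sigma [hs full snu]] := full_cones_cover hT hcomplete (nu + nu').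
rewrite (support_functionE hSF hs snu) pairing_dot dotDl -pairing_dot.
by apply: lerD; apply: (section_exponent_ge hT hcomplete hSF); exact: hm.
Qed.

(* Where [h = m sigma], all of [P_D - m sigma], hence [Gamma sigma] and its dual
   cone, is nonnegative. *)
Lemma strict_of_generation sigma nu : Sigma sigma ->
  Gamma sigma `<=` semigroup_gen (differences sigma) ->
  h nu = pairing nu (toR R (m sigma)) <-> sigma nu.
Proof.
move=> hs gen; split=> [hnu|]; last exact: (support_functionE hSF hs).
apply: cone_bidual; first exact: (triple_rational hT hs).
move=> x; rewrite -(Gamma_hull hT hs) => -[n [a [c [ac ->]]]].
rewrite pairing_sumZr; apply: sumr_ge0 => i _.
have [[v /gen hv <-] ci] := ac i; apply: mulr_ge0 => //.
pose N := [set v : MZ | 0 <= pairing nu (toR R v)].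
apply: (@semigroup_gen_min _ _ N _ _ v hv) => [v1 v2|_ [u hu <-]].
  by rewrite /N /= pairingDr; exact: addr_ge0.
rewrite /N /= pairingBr subr_ge0 -hnu.
exact: (section_exponent_ge hT hcomplete hSF).
Qed.

Hypothesis hva : very_ample k Sigma Gamma m.

Lemma very_ample_vertex sigma : Sigma sigma -> cone_dim sigma d -> PD (m sigma).
Proof.
move=> hs full; have [n [s [phi [[s_sec _ _] s_free _ _]]]] := hva.
have Tfix := toric_fixed_point hT hs full k.
have [j] := s_free sigma _ hs Tfix.
have [S [hS SE]] := global_section_sum hT hcomplete hSF (s_sec j).
rewrite SE//; apply: contraNP => nm; rewrite big_seq big1// => p pS.
rewrite /fixed_point subr_eq0; case: eqP => [e|_]; last by rewrite mulr0.
by case: nm; rewrite -e; exact: hS.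
Qed.

(* Near the fixed point [x0] of the chart, [t^v] is a quotient of two elements
   of the semigroup algebra of [P_D - m sigma], whose denominator has a nonzero
   constant term. *)
Lemma very_ample_generation sigma : Sigma sigma -> cone_dim sigma d ->
  Gamma sigma `<=` semigroup_gen (differences sigma).
Proof.
move=> hs full v hv; have [n [s [phi [[s_sec _ _] s_free phiE clim]]]] := hva.
set A := semigroup_gen _.
have A0 : A 0.
  apply: sub_semigroup_gen; exists (m sigma); last by rewrite subrr.
  exact: very_ample_vertex.
have AD : add_closed_set A by exact: semigroup_genD.
have AG : A `<=` Gamma sigma by exact: differences_sub.
pose x0 : MZ -> k := @fixed_point d k.
have Tfix : pt sigma x0 := toric_fixed_point hT hs full k.
pose row x := \row_j s j sigma x.
have row_neq0 x : pt sigma x -> row x != 0.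
  move=> Tx; have [j sj] := s_free sigma x hs Tx.
  by apply: contraNneq sj => /rowP/(_ j); rewrite !mxE => ->.
have rowE e p : homog_poly e p -> exists S : seq (k * MZ),
    (forall q, q \in S -> A q.2) /\
    forall x, pt sigma x -> eval_row p (row x) = \sum_(q <- S) q.1 * x q.2.
  move=> hp; have /choice[S hS] := fun j => global_section_sum hT hcomplete hSF (s_sec j).
  pose f j x := \sum_(q <- S j) q.1 * x (q.2 - m sigma).
  have hf j : toric_fun A (f j).
    exists [seq (q.1, q.2 - m sigma) | q <- S j]; split=> [q /mapP[r rS ->]|x _].
      by apply: sub_semigroup_gen; exists r.2 => //; exact: (hS j).1.
    by rewrite big_map.
  have [Q [hQ QE]] := toric_fun_eval_row A0 AD hp hf.
  exists Q; split=> // x Tx.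
  have TA := toric_points_restrict AG A0 AD Tx.
  have := QE _ TA; rewrite big_seq [in X in _ -> X]big_seq.
  under eq_bigr => q /hQ hq do rewrite restrict_pointE//.
  move=> <-; congr (eval_row p _); apply/rowP => j; rewrite !mxE (hS j).2//.
  rewrite /f big_seq [RHS]big_seq; apply: eq_bigr => q /(hS j).1 hq.
  by rewrite restrict_pointE//; apply: sub_semigroup_gen; exists q.2.
have [_ _ _ _ germ] := clim.
have [|V [psi [Vop Vreg Vx fpsi]]] := germ _ _ (chart sigma x0)
    (chart_domain_open k hT hs) (chart_monomial_regular hT hs hv).
  by exists x0.
rewrite phiE// in Vx.
have [_ /(_ _ (row_neq0 _ Tfix) Vx)[e [p [hp px pV]]]] := Vop.
have [e' [P [Q [hP hQ Qx psiE]]]] := Vreg _ (row_neq0 _ Tfix) Vx.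
have [Sp [hSp SpE]] := rowE _ _ hp.
have [SP [hSP SPE]] := rowE _ _ hP.
have [SQ [hSQ SQE]] := rowE _ _ hQ.
have funS S : (forall q, q \in S -> A q.2) ->
    toric_fun A (fun x : MZ -> k => \sum_(q <- S) q.1 * x q.2) by exists S.
have [num [hnum numE]] := toric_funM AD (toric_funM AD (funS _ hSP) (funS _ hSp))
  (funS _ hSQ).
have [den [hden denE]] := toric_funM AD (toric_funM AD (funS _ hSQ) (funS _ hSp))
  (funS _ hSQ).
have resE S x : (forall q, q \in S -> A q.2) ->
    \sum_(q <- S) q.1 * restrict_point A x q.2 = \sum_(q <- S) q.1 * x q.2 :> k.
  move=> hS; rewrite big_seq [RHS]big_seq; apply: eq_bigr => q /hS hq.
  by rewrite restrict_pointE.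
have Tres x : pt sigma x -> toric_points A (restrict_point A x).
  exact: toric_points_restrict.
have := @torus_mul_coef k d [:: (1, v)] den num _ v; rewrite big_seq1 => coefE.
have : \sum_(q <- num | q.2 == v) q.1 != 0.
  rewrite -coefE => [|x Tx].
    under eq_bigl => b do rewrite -subr_eq0 /= addrAC subrr add0r.
    under eq_bigr => b _ do rewrite mul1r.
    have -> : \sum_(b <- den | b.2 == 0) b.1 = \sum_(b <- den) b.1 * x0 b.2.
      rewrite big_mkcond; apply: eq_bigr => b _; rewrite /x0 /fixed_point.
      by case: eqP => _; rewrite ?mulr1 ?mulr0.
    rewrite -(resE den)// -denE; last exact: Tres.
    by rewrite !resE// -SQE// -SpE// !mulf_neq0.
  rewrite big_seq1 mul1r /=.
  have Tr : pt sigma (restrict_point (Gamma sigma) x).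
    apply: (toric_points_restrict (fun _ _ => I)) Tx; first exact: (Gamma0 hT).
    exact: (GammaD hT).
  set r := restrict_point _ x in Tr.
  have xr S : (forall q, q \in S -> A q.2) ->
      \sum_(q <- S) q.1 * x q.2 = \sum_(q <- S) q.1 * r q.2.
    move=> hS; rewrite big_seq [RHS]big_seq; apply: eq_bigr => q /hS/AG hq.
    by rewrite /r restrict_pointE.
  rewrite !xr// -(resE den)// -(resE num)// -denE; last exact: Tres.
  rewrite -numE; last exact: Tres.
  rewrite !resE// -SQE// -SpE// -SPE//.
  have [->|pr] := eqVneq (eval_row p (row r)) 0; first by rewrite !(mulr0, mul0r).
  have [->|Qr] := eqVneq (eval_row Q (row r)) 0; first by rewrite !(mulr0, mul0r).
  have Vr : V <[row r]>%VS by apply: pV => //; exact: row_neq0.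
  have : chart_coord Sigma Gamma sigma (chart sigma r) v = psi (phi (chart sigma r)).
    by apply: fpsi; [exists r|rewrite phiE].
  rewrite chart_coordE// phiE// psiE// ?row_neq0// /r restrict_pointE// => ->.
  by field.
apply: contraNP => nv; rewrite big_seq_cond big1// => q /andP[/hnum hq /eqP qv].
by rewrite qv in hq.
Qed.

Lemma very_ample_convex : strictly_upper_convex Sigma h m /\
  forall sigma, Sigma sigma -> cone_dim sigma d ->
    semigroup_gen (differences sigma) = Gamma sigma.
Proof.
split; [split|move=> sigma hs full; apply/seteqP; split].
- exact: upper_convex_of_vertices very_ample_vertex.
- move=> sigma hs full nu; apply: strict_of_generation => //.
  exact: very_ample_generation.
- exact: differences_sub.
- exact: very_ample_generation.
Qed.

End VeryAmpleImpliesConvex.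

(** * Strictly convex generated divisors are very ample *)

Lemma eval_rowZ (k : fieldType) n e p a (v : 'rV[k]_n) : homog_poly e p ->
  eval_row p (a *: v) = a ^+ e * eval_row p v.
Proof.
move=> /homog_polyE[r [c [b [be pE]]]]; rewrite !pE mulr_sumr.
apply: eq_bigr => i _; rewrite mulrCA; congr (_ * _).
rewrite -(be i) -prodrXr -big_split; apply: eq_bigr => j _ /=.
by rewrite mxE exprMn.
Qed.

Lemma vline_eqP (k : fieldType) (V : vectType k) (v w : V) : v != 0 ->
  <[v]>%VS = <[w]>%VS -> exists2 a, a != 0 & v = a *: w.
Proof.
move=> v0 vw; have : v \in <[w]>%VS by rewrite -vw memv_line.
move=> /vlineP[a va]; exists a => //.
by apply: contraNneq v0 => a0; rewrite va a0 scale0r.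
Qed.

Lemma vlineZ (k : fieldType) (V : vectType k) (a : k) (v : V) : a != 0 ->
  <[a *: v]>%VS = <[v]>%VS.
Proof.
move=> a0; apply/eqP; rewrite eqEsubv -!memvE memvZ ?memv_line//=.
by rewrite -{1}[v](scalerK a0) memvZ ?memv_line.
Qed.

Lemma bounded_finite d (B : nat) (S : set 'rV[int]_d) :
  (forall u, S u -> forall i, `|u ord0 i| <= B%:Z) -> finite_set S.
Proof.
move=> hS; pose f (g : {ffun 'I_d -> 'I_(B + B).+1}) : 'rV[int]_d :=
  \row_i ((g i : nat)%:Z - B%:Z).
apply: (@sub_finite_set _ _ [set f g | g in setT]); last first.
  by apply: finite_image; exact: finite_finset.
move=> u /hS hu; exists [ffun i => inord `|(u ord0 i + B%:Z)%R|] => //.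
apply/rowP => i; rewrite mxE ffunE inordK; have := hu i; rewrite ler_norml;
  move: (u ord0 i) => z; lia.
Qed.

Section SemigroupRepresentation.
Variables (M : zmodType) (n : nat) (g : 'I_n -> M).

Lemma semigroup_gen_repr v : semigroup_gen (range g) v ->
  exists a : 'I_n -> nat, v = \sum_j g j *+ a j.
Proof.
apply: (@semigroup_gen_min _ _ [set v | exists a : 'I_n -> nat, v = \sum_j g j *+ a j]).
  move=> u w [a ->] [b ->]; exists (fun j => a j + b j)%N.
  by rewrite -big_split; apply: eq_bigr => j _; rewrite mulrnDr.
move=> _ [i _ <-]; exists (fun j => (j == i) : nat).
rewrite (bigD1 i)//= eqxx mulr1n big1 ?addr0// => j /negPf ->.
by rewrite mulr0n.
Qed.

End SemigroupRepresentation.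

Section ConvexImpliesVeryAmple.
Variables (R : realType) (k : closedFieldType) (d : nat).
Local Notation MZ := 'rV[int]_d.
Local Notation VR := 'rV[R]_d.
Local Notation cone := (set VR).
Variables (Sigma : set cone) (Gamma : cone -> set MZ).
Variables (h : VR -> R) (m : cone -> MZ).
Hypothesis hT : toric_triple Sigma Gamma.
Hypothesis hcomplete : fan_support Sigma = setT.
Hypothesis hSF : support_function Sigma Gamma h m.
Local Notation pt sigma := (@toric_points k MZ (Gamma sigma)).
Local Notation torus := (@toric_points k MZ setT).
Local Notation chart := (@toric_chart R k d Sigma Gamma).
Local Notation X := (toric_variety k Sigma Gamma).
Local Notation PD := (section_exponents Sigma Gamma m).
Implicit Types (sigma : cone) (u v : MZ) (x y : MZ -> k).

Lemma section_exponents_finite : finite_set PD.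
Proof.
pose e i : MZ := delta_mx ord0 i.
have /choice[N hN] : forall i : 'I_d, exists N : nat,
    forall u, PD u -> `|u ord0 i| <= N%:Z.
  move=> i; pose b : R := `|h (toR R (e i))| + `|h (toR R (- e i))|.
  exists (Num.bound b) => u hu.
  have h1 := section_exponent_ge hT hcomplete hSF (toR R (e i)) hu.
  have h2 := section_exponent_ge hT hcomplete hSF (toR R (- e i)) hu.
  have bb : b < (Num.bound b)%:R by apply: archi_boundP; rewrite addr_ge0.
  have eE : pairing (toR R (e i)) (toR R u) = (u ord0 i)%:~R.
    by rewrite pairing_int dotC dot_delta.
  have eNE : pairing (toR R (- e i)) (toR R u) = - (u ord0 i)%:~R.
    by rewrite toRN pairing_dot -scaleN1r dotZl -pairing_dot eE mulN1r.
  rewrite eE in h1; rewrite eNE in h2.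
  rewrite -(ler_int R) intr_norm -pmulrn ler_norml.
  have n1 := ler_norm (- h (toR R (e i))); have n2 := ler_norm (- h (toR R (- e i))).
  rewrite normrN in n1; rewrite normrN in n2.
  have p1 := normr_ge0 (h (toR R (e i))); have p2 := normr_ge0 (h (toR R (- e i))).
  by move: bb; rewrite /b => bb; apply/andP; split; lra.
apply: (@bounded_finite _ (\sum_i N i)%N) => u hu i.
apply: le_trans (hN i u hu) _.
by rewrite lez_nat (bigD1 i)//= leq_addr.
Qed.

Hypothesis hstrict : strictly_upper_convex Sigma h m.
Hypothesis hgen : forall sigma, Sigma sigma -> cone_dim sigma d ->
  semigroup_gen [set u - m sigma | u in PD] = Gamma sigma.

Lemma generated_vertex sigma : Sigma sigma -> cone_dim sigma d -> PD (m sigma).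
Proof.
move=> hs full; pose A := [set u - m sigma | u in PD].
pose B : set MZ := [set v | Gamma sigma v /\ (v = 0 -> A 0)].
have : B 0.
  have : semigroup_gen A 0 by rewrite hgen//; exact: (Gamma0 hT).
  apply: semigroup_gen_min => [u v [hu u0] [hv v0]|v Av].
    split; first exact: (GammaD hT).
    move=> uv0; apply: u0; apply: (full_Gamma_unit hT hs full) => //.
    by rewrite (addr0_eq uv0).
  by split=> [|<-//]; case: Av => u hu <-; exact: hu.
by move=> [_ /(_ erefl)[u hu /eqP]]; rewrite subr_eq0 => /eqP <-.
Qed.

Lemma enumerate_sections : exists n (e : 'I_n.+1 -> MZ),
  injective e /\ range e = PD.
Proof.
have /finite_seqP[s sE] := section_exponents_finite.
have [sigma [hs full _]] := full_cones_cover hT hcomplete 0.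
have := generated_vertex hs full; rewrite sE /= -mem_undup.
case us: (undup s) => [//|a r] _; exists (size r), (fun j => (undup s)`_j); split.
  move=> i j /eqP; rewrite nth_uniq ?undup_uniq ?us ?ltn_ord//.
  by move=> /eqP; exact: val_inj.
apply/seteqP; split=> [_ [j _ <-]|u] /=.
  by rewrite -mem_undup mem_nth// us.
rewrite -mem_undup => us'; have lt : (index u (undup s) < (size r).+1)%N.
  by rewrite -[(size r).+1]/(size (a :: r)) -us index_mem.
by exists (Ordinal lt) => //=; rewrite nth_index.
Qed.

Variables (n : nat) (e : 'I_n.+1 -> MZ).
Hypotheses (e_inj : injective e) (eE : range e = PD).

Let e_section j : PD (e j). Proof. by rewrite -eE; exists j. Qed.

Let e_Gamma sigma j : Sigma sigma -> Gamma sigma (e j - m sigma).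
Proof. by move=> hs; exact: e_section. Qed.

Definition monomial_section (j : 'I_n.+1) sigma x : k := x (e j - m sigma).

Definition section_row sigma x : 'rV[k]_n.+1 := \row_j monomial_section j sigma x.

Lemma vertex_index sigma : Sigma sigma -> cone_dim sigma d ->
  exists j, e j = m sigma.
Proof.
by move=> hs full; have := generated_vertex hs full; rewrite -eE => -[j _]; exists j.
Qed.

Lemma monomial_basis : basis_of_sections (k := k) Sigma Gamma m monomial_section.
Proof.
split=> [j|c c0 j|s /(global_section_sum hT hcomplete hSF)[S [hS sE]]].
- exact: (global_section_monomial k hT hSF).
- have h0 := zero_cone hT hcomplete; have G0 := Gamma_zero_cone hT hcomplete.
  pose S := [seq (c j, e j - m [set 0]) | j <- enum 'I_n.+1].
  have := @torus_coef k d S _ (e j - m [set 0]).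
  rewrite /S big_map big_enum_cond /= => <-.
    rewrite (big_pred1 j)// => i; rewrite /= (inj_eq (addIr _)).
    by rewrite (inj_eq e_inj).
  move=> x Tx; rewrite big_map big_enum /=.
  by have := c0 [set 0] x h0; rewrite G0 => /(_ Tx).
- exists (fun j => \sum_(p <- S | p.2 == e j) p.1) => sigma x hs Tx.
  rewrite sE// /lin_comb_section.
  under [RHS]eq_bigr do rewrite mulr_suml.
  rewrite (exchange_big_dep predT)//= big_seq [RHS]big_seq.
  apply: eq_bigr => p /hS; rewrite -eE => -[j _ pj].
  rewrite (big_pred1 j); first by rewrite /monomial_section pj.
  by move=> i; rewrite /= -pj (inj_eq e_inj) eq_sym.
Qed.

Lemma section_row_vertex sigma x j : pt sigma x -> e j = m sigma ->
  section_row sigma x ord0 j = 1.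
Proof. by move=> [x0 _ _] ej; rewrite mxE /monomial_section ej subrr. Qed.

Lemma exists_section_neq0 tau x : Sigma tau -> pt tau x ->
  exists j, monomial_section j tau x != 0.
Proof.
move=> ht Tx; have [sigma [hs full ts]] := full_coface hT hcomplete ht.
have [j ej] := vertex_index hs full; exists j; rewrite /monomial_section ej.
have [h1 h2] := transition_unit hT hSF hs ts.
by apply: (toric_point_unit Tx h2); rewrite opprB.
Qed.

Lemma section_row_neq0 tau x : Sigma tau -> pt tau x -> section_row tau x != 0.
Proof.
move=> ht Tx; have [j] := exists_section_neq0 ht Tx.
by apply: contraNneq => /rowP/(_ j); rewrite !mxE => ->.
Qed.

Lemma section_row_glued sigma x sigma' x' : Sigma sigma -> Sigma sigma' ->
  pt sigma x -> pt sigma' x' -> chart sigma x = chart sigma' x' ->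
  exists2 a, a != 0 & section_row sigma x = a *: section_row sigma' x'.
Proof.
move=> hs hs' Tx Tx' /(chart_eqP hT hs hs' Tx Tx')[y /= Ty [xE x'E]].
have h1 := transition_unitI hT hSF hs hs'.
have h2 := transition_unitI hT hSF hs' hs; rewrite setIC in h2.
exists (y (m sigma' - m sigma)).
  by apply: (toric_point_unit Ty h1); rewrite opprB.
apply/rowP => j; rewrite !mxE /monomial_section xE x'E !restrict_pointE; try exact: e_Gamma.
have [_ yD _] := Ty; rewrite -yD//; first by rewrite [in RHS]addrC subrKA.
have := e_Gamma j hs'; rewrite setIC; apply: (Gamma_sub hT hs').
exact: (triple_faceI hT).
Qed.

Definition section_map c : {vspace 'rV[k]_n.+1} :=
  xget 0%VS [set L | exists sigma x,
    [/\ Sigma sigma, pt sigma x, c = chart sigma x & L = <[section_row sigma x]>%VS]].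

Lemma section_mapE sigma x : Sigma sigma -> pt sigma x ->
  section_map (chart sigma x) = <[section_row sigma x]>%VS.
Proof.
move=> hs Tx; rewrite /section_map; case: xgetP => [L _ [s [y [hs' Ty cE ->]]]|].
  have [a a0 ->] := section_row_glued hs hs' Tx Ty cE.
  by rewrite vlineZ.
by move=> /(_ <[section_row sigma x]>%VS)[]; exists sigma, x.
Qed.

Lemma vertex_overlap sigma sigma' y j : Sigma sigma -> cone_dim sigma d ->
  Sigma sigma' -> pt sigma' y -> e j = m sigma -> section_row sigma' y ord0 j != 0 ->
  exists x, [/\ pt sigma x, chart sigma' y = chart sigma x &
    exists2 a, a != 0 & section_row sigma' y = a *: section_row sigma x].
Proof.
move=> hs full hs' Ty ej; rewrite mxE /monomial_section => yu.
have uE : sigma `&` sigma' =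
    sigma' `&` [set nu | pairing nu (toR R (e j - m sigma')) = 0].
  rewrite ej; apply/seteqP; split=> nu /= [s1 s2]; split=> //.
    by rewrite pairingBr -!(support_functionE hSF)// subrr.
  apply/(hstrict.2 _ hs full); rewrite (support_functionE hSF hs' s1).
  by move/eqP: s2; rewrite pairingBr subr_eq0 => /eqP.
have [z Tz [_ cE]] := chart_overlap hT hs hs' (e_Gamma j hs') uE Ty yu.
have Tx : pt sigma (restrict_point (Gamma sigma) z).
  by apply: (toric_points_face hT) Tz => //; exact: (triple_faceI hT).
exists (restrict_point (Gamma sigma) z); split=> //.
exact: section_row_glued cE.
Qed.

Lemma generated_by_range sigma : Sigma sigma -> cone_dim sigma d ->
  Gamma sigma = semigroup_gen (range (fun j => e j - m sigma)).
Proof.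
move=> hs full; rewrite -hgen// -eE; congr (semigroup_gen _).
by apply/seteqP; split=> [_ [_ [j _ <-] <-]|_ [j _ <-]]; [exists j|exists (e j) => //; exists j].
Qed.

Lemma section_row_inj sigma x y : Sigma sigma -> cone_dim sigma d ->
  pt sigma x -> pt sigma y -> section_row sigma x = section_row sigma y -> x = y.
Proof.
move=> hs full Tx Ty /rowP xy; apply: (toric_points_ext Tx Ty) => v hv.
suff : [set v | Gamma sigma v /\ x v = y v] v by case.
move: hv; rewrite {1}generated_by_range//; apply: semigroup_gen_min.
  move=> u w [hu xu] [hw xw]; split; first exact: (GammaD hT).
  by have [_ -> //] := Tx; have [_ -> //] := Ty; rewrite xu xw.
by move=> _ [j _ <-]; split; [exact: e_Gamma|have := xy j; rewrite !mxE].
Qed.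

Lemma section_map_inj c c' : points X c -> points X c' ->
  section_map c = section_map c' -> c = c'.
Proof.
move=> /(points_full_chart hT hcomplete)[sigma [x [hs full Tx ->]]].
move=> /(points_full_chart hT hcomplete)[sigma' [x' [hs' _ Tx' ->]]].
rewrite !section_mapE// => /(vline_eqP (section_row_neq0 hs Tx))[a a0 xE].
have [j ej] := vertex_index hs full.
have x'j : section_row sigma' x' ord0 j != 0.
  apply: contraTneq (oner_neq0 k) => x'0; rewrite -(section_row_vertex Tx ej) xE mxE.
  by rewrite x'0 mulr0 eqxx.
have [y [Ty -> [b b0 x'E]]] := vertex_overlap hs full hs' Tx' ej x'j.
congr (chart sigma _); apply: (section_row_inj hs full Tx Ty).
move: xE; rewrite x'E scalerA => xE.
have := congr1 (fun w : 'rV[k]_n.+1 => w ord0 j) xE.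
rewrite (section_row_vertex Tx ej) [RHS]mxE (section_row_vertex Ty ej) mulr1 => ab.
by rewrite xE -ab scale1r.
Qed.

Lemma eval_section_row sigma E p : Sigma sigma -> homog_poly E p ->
  toric_fun (Gamma sigma) (fun x : MZ -> k => eval_row p (section_row sigma x)).
Proof.
move=> hs hp; apply: (toric_fun_eval_row (Gamma0 hT hs) (GammaD hT hs) hp) => j.
by apply: toric_fun_monomial; exact: e_Gamma.
Qed.

Lemma section_map_morphism : is_morphism X (projective_space k n) section_map.
Proof.
split=> [c|V Vop|V psi Vop Vreg].
- move=> [sigma [x [hs Tx ->]]].
  by rewrite -[glue_class _ _ _ _ _]/(chart sigma x) section_mapE//= dim_vline section_row_neq0.
- apply/toric_opensP; split=> [c []//|sigma hs]; apply/opensP; split=> [x []//|].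
  move=> x [Tx [_ Vx]]; move: Vx; rewrite /= section_mapE// => Vx.
  have [_ /(_ _ (section_row_neq0 hs Tx) Vx)[E [p [hp px pV]]]] := Vop.
  exists (fun x => eval_row p (section_row sigma x)); first exact: eval_section_row hp.
  split=> // y Ty py; split=> //; split; first exact: points_chart.
  by rewrite /= section_mapE//; apply: pV => //; exact: section_row_neq0.
- apply/toric_regularP => sigma hs; apply/regular_onP => [|x [Tx [_ Vx]]].
    by move=> x [].
  move: Vx; rewrite /= section_mapE// => Vx.
  have [E [P [Q [hP hQ Qx psiE]]]] := Vreg _ (section_row_neq0 hs Tx) Vx.
  exists (fun x => eval_row P (section_row sigma x)),
         (fun x => eval_row Q (section_row sigma x)); split=> //.
  + exact: eval_section_row hP.
  + exact: eval_section_row hQ.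
  + move=> y [Ty [_ Vy]] Qy; move: Vy; rewrite /= section_mapE// => Vy.
    by apply: psiE => //; exact: section_row_neq0.
Qed.

Lemma section_row_monomial sigma x (a : 'I_n.+1 -> nat) : Sigma sigma -> pt sigma x ->
  \prod_j section_row sigma x ord0 j ^+ a j = x (\sum_j (e j - m sigma) *+ a j).
Proof.
move=> hs Tx; have G0 := Gamma0 hT hs; have GD := GammaD hT hs.
rewrite (toric_point_sum G0 GD _ Tx).
  by apply: eq_bigr => j _; rewrite mxE (toric_pointMn G0 GD _ Tx)//; exact: e_Gamma.
by move=> j; apply: semigroupMn => //; exact: e_Gamma.
Qed.

(* Every monomial of the homogenization contains the coordinate [t^(m sigma)],
   which is [1] on the chart of [sigma]. *)
Lemma homogenization sigma j0 f : Sigma sigma -> cone_dim sigma d ->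
  e j0 = m sigma -> toric_fun (Gamma sigma) f ->
  exists E0, forall E, (E0 <= E)%N -> exists p,
    [/\ homog_poly E p,
        forall x : MZ -> k, pt sigma x -> eval_row p (section_row sigma x) = f x &
        forall w : 'rV[k]_n.+1, w ord0 j0 = 0 -> eval_row p w = 0].
Proof.
move=> hs full ej0 [S [hS fE]].
have /choice[a ha] : forall i : 'I_(size S), exists a : 'I_n.+1 -> nat,
    (nth (0, 0) S i).2 = \sum_j (e j - m sigma) *+ a j.
  move=> i; apply: semigroup_gen_repr; rewrite -generated_by_range//.
  exact/hS/mem_nth.
pose deg i := (\sum_j a i j)%N.
exists (\sum_i deg i).+1 => E hE.
have degE i : (deg i < E)%N by apply: leq_trans hE; rewrite ltnS (bigD1 i)//= leq_addr.
pose b i j := (a i j + (j == j0) * (E - deg i))%N.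
have [i|p [hp pE]] := @homog_poly_sum k n.+1 E _ (fun i => (nth (0, 0) S i).1) b.
  rewrite big_split/= -/(deg i) -big_distrl/= (bigD1 j0)//= eqxx big1 => [|j /negPf ->//].
  by rewrite addn0 mul1n subnKC// ltnW.
exists p; split=> // [x Tx|w w0]; rewrite pE; last first.
  rewrite big1// => i _; rewrite (bigD1 j0)//= w0 /b eqxx mul1n expr0n.
  have := degE i; rewrite -subn_gt0 addn_eq0 => /prednK <-.
  by rewrite andbF mul0r mulr0.
rewrite fE// (big_nth (0, 0)) big_mkord; apply: eq_bigr => i _; congr (_ * _).
rewrite ha -section_row_monomial//; apply: eq_bigr => j _.
rewrite /b exprD; case: eqVneq => [->|_]; last by rewrite mul0n expr0 mulr1.
by rewrite (section_row_vertex Tx ej0) !expr1n mulr1.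
Qed.

Lemma section_map_embedding U : opens X U ->
  exists2 V, opens (projective_space k n) V & U = pullback_set X section_map V.
Proof.
move=> /toric_opensP[UX Uop].
pose good p := forall sigma x, Sigma sigma -> pt sigma x ->
  eval_row p (section_row sigma x) != 0 -> U (chart sigma x).
exists [set L | exists (v : 'rV[k]_n.+1) E p, [/\ v != 0, L = <[v]>%VS, homog_poly E p,
                                  eval_row p v != 0 & good p]].
  split=> [_ [v [E [p [v0 -> _ _ _]]]]|v v0]; first by rewrite /= dim_vline v0.
  move=> [v' [E [p [v'0 vv' hp pv' gp]]]]; exists E, p; split=> //.
    have [a a0 ->] := vline_eqP v0 vv'.
    by rewrite (eval_rowZ _ _ hp) mulf_neq0// expf_neq0.
  by move=> w w0 pw; exists w, E, p.
apply/seteqP; split=> c.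
  move=> Uc; split; first exact: UX.
  have [sigma [x [hs full Tx cE]]] := points_full_chart hT hcomplete (UX _ Uc).
  have [_ /(_ x)[|f hf [fx fU]]] := (opensP _ _).1 (Uop _ hs).
    by split=> //=; rewrite -cE.
  have [j ej] := vertex_index hs full.
  have [E /(_ E (leqnn E))[p [hp pf p0]]] := homogenization hs full ej hf.
  exists (section_row sigma x), E, p; split=> //.
  - exact: section_row_neq0.
  - by rewrite cE section_mapE.
  - by rewrite pf.
  - move=> sigma' y hs' Ty py.
    have yj : section_row sigma' y ord0 j != 0.
      by apply: contraNneq py => /p0 ->.
    have [x' [Tx' -> [a a0 rE]]] := vertex_overlap hs full hs' Ty ej yj.
    have := fU x' Tx'; rewrite -pf// => -[|//].
    move: py; rewrite rE (eval_rowZ _ _ hp) mulf_eq0 negb_or.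
    by case/andP.
move=> [Xc [v [E [p [v0 cE hp pv gp]]]]].
have [sigma [x [hs _ Tx ec]]] := points_full_chart hT hcomplete Xc.
rewrite ec in cE *; apply: gp => //; move: cE; rewrite section_mapE//.
move=> /(vline_eqP (section_row_neq0 hs Tx))[a a0 ->].
by rewrite (eval_rowZ _ _ hp) mulf_neq0// expf_neq0.
Qed.

Lemma section_map_germs U f c : opens X U -> regular_on X U f -> U c ->
  exists V psi, [/\ opens (projective_space k n) V,
    regular_on (projective_space k n) V psi, V (section_map c) &
    forall c', U c' -> V (section_map c') -> f c' = psi (section_map c')].
Proof.
move=> /toric_opensP[UX Uop] /toric_regularP freg Uc.
have [sigma [x [hs full Tx cE]]] := points_full_chart hT hcomplete (UX _ Uc).
have Usub : pullback_set (affine_toric k (Gamma sigma)) (chart sigma) U `<=` pt sigma.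
  by move=> y [].
have Ux : pullback_set (affine_toric k (Gamma sigma)) (chart sigma) U x.
  by split=> //=; rewrite -cE.
have [f1 [g1 [hf hg g1x fg]]] := (regular_onP _ Usub).1 (freg _ hs) x Ux.
have [j ej] := vertex_index hs full.
have [EP hEP] := homogenization hs full ej hf.
have [EQ hEQ] := homogenization hs full ej hg.
have [P [hP Pf _]] := hEP _ (leq_maxl EP EQ).
have [Q [hQ Qg Q0]] := hEQ _ (leq_maxr EP EQ).
set E := maxn EP EQ in hP hQ.
pose psi L := eval_row P (vpick L) / eval_row Q (vpick L).
have psiE w : w != 0 -> psi <[w]>%VS = eval_row P w / eval_row Q w.
  move=> w0; have : vpick <[w]>%VS \in <[w]>%VS by exact: memv_pick.
  move=> /vlineP[a aE]; have a0 : a != 0.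
    apply: contraNneq w0 => a0; move/eqP: aE; rewrite a0 scale0r vpick0.
    by move=> /eqP w00; rewrite -memv0 -w00 memv_line.
  rewrite /psi aE (eval_rowZ _ _ hP) (eval_rowZ _ _ hQ) -mulf_div divff ?mul1r//.
  exact: expf_neq0.
exists [set L | exists v : 'rV[k]_n.+1, [/\ v != 0, L = <[v]>%VS & eval_row Q v != 0]], psi.
have QV (v w : 'rV[k]_n.+1) : v != 0 -> <[v]>%VS = <[w]>%VS ->
    eval_row Q w != 0 -> eval_row Q v != 0.
  move=> v0 /(vline_eqP v0)[a a0 ->] Qw.
  by rewrite (eval_rowZ _ _ hQ) mulf_neq0// expf_neq0.
split.
- split=> [_ [v [v0 -> _]]|v v0 [w [w0 vw Qw]]]; first by rewrite /= dim_vline v0.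
  by exists E, Q; split=> //; [exact: QV vw Qw|move=> w' w'0 Qw'; exists w'].
- move=> v v0 [w [w0 vw Qw]]; exists E, P, Q; split=> //; first exact: QV vw Qw.
  by move=> w' w'0 _ _; exact: psiE.
- exists (section_row sigma x); split=> //; first exact: section_row_neq0.
    by rewrite cE section_mapE.
  by rewrite Qg.
- move=> c' Uy [v [v0 yE Qv]].
  have [sigma' [y' [hs' _ Ty' ey]]] := points_full_chart hT hcomplete (UX _ Uy).
  rewrite ey section_mapE// in yE.
  have Qy := QV _ _ (section_row_neq0 hs' Ty') yE Qv.
  have yj : section_row sigma' y' ord0 j != 0.
    by apply: contraNneq Qy => /Q0 ->.
  have [x' [Tx' e' [a a0 rE]]] := vertex_overlap hs full hs' Ty' ej yj.
  rewrite ey e' section_mapE// psiE ?section_row_neq0// Pf// Qg//.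
  apply: fg; first by split=> //=; rewrite -e' -ey.
  rewrite -Qg//; move: Qy; rewrite rE (eval_rowZ _ _ hQ) mulf_eq0 negb_or.
  by case/andP.
Qed.

Lemma vertex_convex_combination j : exists (N : nat) (b : 'I_n.+1 -> nat),
  [/\ (0 < N)%N, (\sum_i b i = N)%N, e j *+ N = \sum_i e i *+ b i &
      forall i, (0 < b i)%N -> exists sigma,
        [/\ Sigma sigma, cone_dim sigma d & e i = m sigma]].
Proof.
pose vertex i := exists sigma, [/\ Sigma sigma, cone_dim sigma d & e i = m sigma].
pose one : 'rV[int]_1 := const_mx 1.
pose g i : 'rV[int]_(d + 1) := if `[< vertex i >] then row_mx (e i) one else 0.
have dotE (y : 'rV[int]_(d + 1)) u :
      dot y (row_mx u one) = dot (lsubmx y) u + rsubmx y ord0 ord0.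
  rewrite /dot big_split_ord /= big_ord1 row_mxEr mxE mulr1 [rsubmx _ _ _]mxE; congr (_ + _).
  by apply: eq_bigr => i _; rewrite row_mxEl mxE.
have [y hy|N [c [N0 uN]]] := @int_farkas (d + 1) n.+1 g (row_mx (e j) one).
  have [sigma [hs full snu]] := full_cones_cover hT hcomplete (toR R (lsubmx y)).
  have [i ei] := vertex_index hs full.
  have vi : vertex i by exists sigma.
  have := hy i; rewrite /g asboolT// !dotE => h1; apply: le_trans h1 _.
  rewrite lerD2r -(ler_int R) -!pairing_int ei -(support_functionE hSF hs snu).
  exact: (section_exponent_ge hT hcomplete hSF).
pose b i := if `[< vertex i >] then c i else 0%N.
have gE i : g i *+ c i = row_mx (e i *+ b i) (one *+ b i).
  rewrite /g /b; case: ifP => _; last by rewrite !mulr0n mul0rn row_mx0.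
  by elim: (c i) => [|p IHp]; rewrite ?mulr0n ?row_mx0// !mulrS IHp add_row_mx.
have rowMn u p : row_mx u one *+ p = row_mx (u *+ p) (one *+ p).
  by elim: p => [|p IHp]; rewrite ?mulr0n ?row_mx0// !mulrS IHp add_row_mx.
have : row_mx (e j *+ N) (one *+ N) =
    row_mx (\sum_i e i *+ b i) (\sum_i one *+ b i).
  rewrite -rowMn uN (eq_bigr _ (fun i _ => gE i)).
  by elim/big_rec3: _ => [|i u1 u2 u3 _ ->]; rewrite ?row_mx0// add_row_mx.
move=> /eq_row_mx[eN oneN]; exists N, b; split=> //; last first.
  by move=> i; rewrite /b; case: asboolP.
have := congr1 (fun w : 'rV[int]_1 => w ord0 ord0) oneN.
rewrite /= summxE mulmxnE mxE natz.
rewrite (eq_bigr (fun i => (b i)%:Z)) => [|i _]; last by rewrite mulmxnE mxE natz.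
by rewrite -(big_morph Posz PoszD (erefl _)) => -[].
Qed.

(* A vector on which all the homogeneous binomial relations between the sections
   hold defines a point of a chart as soon as one of its vertex coordinates is
   nonzero, and this must happen since every exponent is a rational convex
   combination of the vertices. *)
Lemma section_map_closed_vector (v : 'rV[k]_n.+1) : v != 0 ->
  (forall a b : 'I_n.+1 -> nat, (\sum_j a j = \sum_j b j)%N ->
     \sum_j e j *+ a j = \sum_j e j *+ b j ->
     \prod_j v ord0 j ^+ a j = \prod_j v ord0 j ^+ b j) ->
  exists sigma x, [/\ Sigma sigma, pt sigma x & <[v]>%VS = <[section_row sigma x]>%VS].
Proof.
move=> v0 binom.
have [j0 [sigma [hs full ej0 vj0]]] : exists j0 sigma,
    [/\ Sigma sigma, cone_dim sigma d, e j0 = m sigma & v ord0 j0 != 0].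
  apply: contrapT => nov; case/eqP: v0; apply/rowP => j; rewrite mxE.
  have [N [b [N0 bN eN bv]]] := vertex_convex_combination j.
  have := binom (fun i => (i == j) * N)%N b; rewrite -big_distrl/= -{1}bN.
  rewrite (bigD1 j)//= eqxx big1 => [|i /negPf ->//]; rewrite mul1n => /(_ erefl).
  rewrite (bigD1 j)//= eqxx mul1n big1 => [|i /negPf ->//].
  rewrite addr0 => /(_ eN); rewrite (bigD1 j)//= eqxx mul1n big1 => [|i /negPf ->]; last first.
    by rewrite mul0n expr0.
  rewrite mulr1 => vN; apply/eqP; suff : v ord0 j ^+ N == 0 by rewrite expf_eq0 N0.
  have [i bi] : exists i, (0 < b i)%N.
    apply: contrapT => nb; move: N0; rewrite -bN big1// => i _.
    by apply/eqP; rewrite -leqn0 leqNgt; apply/negP => bi; apply: nb; exists i.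
  have [s [hs full ei]] := bv i bi.
  have vi : v ord0 i = 0.
    by apply/eqP; apply: contraPT nov => vi; apply; exists i, s.
  by rewrite vN (bigD1 i)//= vi expr0n gtn_eqF//= mul0r.
pose r j := v ord0 j / v ord0 j0.
have G0 := Gamma0 hT hs; have GD := GammaD hT hs.
have wd (a b : 'I_n.+1 -> nat) :
    \sum_j (e j - m sigma) *+ a j = \sum_j (e j - m sigma) *+ b j ->
    \prod_j r j ^+ a j = \prod_j r j ^+ b j.
  have sumE (c : 'I_n.+1 -> nat) : \sum_j (e j - m sigma) *+ c j =
      \sum_j e j *+ c j - m sigma *+ (\sum_j c j)%N.
    under [LHS]eq_bigr do rewrite mulrnBl.
    by rewrite sumrB -sumrMnr.
  have prodE (c : 'I_n.+1 -> nat) : \prod_j r j ^+ c j =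
      (\prod_j v ord0 j ^+ c j) / v ord0 j0 ^+ (\sum_j c j)%N.
    rewrite -prodrXr -prodf_div; apply: eq_bigr => j _.
    by rewrite /r expr_div_n.
  rewrite !sumE !prodE => ab; apply/eqP; rewrite eqr_div ?expf_neq0//; apply/eqP.
  pose shift (c : 'I_n.+1 -> nat) p j := (c j + (j == j0) * p)%N.
  have shift_sum c p : (\sum_j shift c p j = \sum_j c j + p)%N.
    rewrite big_split /=; congr (_ + _)%N.
    rewrite -big_distrl /= (bigD1 j0)//= eqxx big1 => [|j /negPf ->//].
    by rewrite mul1n.
  have shift_exp c p : \sum_j e j *+ shift c p j = \sum_j e j *+ c j + m sigma *+ p.
    under [LHS]eq_bigr do rewrite mulrnDr.
    rewrite big_split /=; congr (_ + _).
    rewrite (bigD1 j0)//= eqxx mul1n ej0 big1 ?addr0// => j /negPf ->.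
    by rewrite mul0n mulr0n.
  have shift_prod c p : \prod_j v ord0 j ^+ shift c p j =
      (\prod_j v ord0 j ^+ c j) * v ord0 j0 ^+ p.
    under [LHS]eq_bigr do rewrite exprD.
    rewrite big_split /=; congr (_ * _).
    rewrite (bigD1 j0)//= eqxx mul1n big1 ?mulr1// => j /negPf ->.
    by rewrite mul0n expr0.
  have := binom (shift a (\sum_j b j)%N) (shift b (\sum_j a j)%N).
  rewrite !shift_sum !shift_exp !shift_prod [RHS in _ = RHS -> _]addnC => ->//.
  by apply/eqP; move/eqP: ab; rewrite subr_eq addrAC eq_sym subr_eq eq_sym.
have /choice[a ha] : forall w : MZ, exists a : 'I_n.+1 -> nat,
    Gamma sigma w -> w = \sum_j (e j - m sigma) *+ a j.
  move=> w; have [|hw] := pselect (Gamma sigma w); last by exists (fun=> 0%N).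
  by rewrite {1}generated_by_range// => /semigroup_gen_repr[a ->]; exists a.
pose y w := if w \in Gamma sigma then \prod_j r j ^+ a w j else 0.
have yE w c : Gamma sigma w -> w = \sum_j (e j - m sigma) *+ c j ->
    y w = \prod_j r j ^+ c j.
  by move=> hw wE; rewrite /y mem_set//; apply: wd; rewrite -wE -ha.
have Ty : pt sigma y.
  split=> [|u w hu hw|w hw]; last by rewrite /y memNset.
    rewrite (@yE 0 (fun=> 0%N))//; first by rewrite big1.
    by rewrite big1.
  rewrite (@yE _ (fun j => a u j + a w j)%N); [|exact: GD|].
    rewrite (yE u (a u))//; last exact: ha.
    rewrite (yE w (a w))//; last exact: ha.
    by rewrite -big_split; apply: eq_bigr => j _; rewrite exprD.
  rewrite {1}(ha u hu) {1}(ha w hw) -big_split.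
  by apply: eq_bigr => j _; rewrite mulrnDr.
exists sigma, y; split=> //.
suff -> : v = v ord0 j0 *: section_row sigma y by exact: vlineZ.
apply/rowP => j; rewrite !mxE /monomial_section.
rewrite (@yE _ (fun i => (i == j) : nat)); last 2 first.
- exact: e_Gamma.
- by rewrite (bigD1 j)//= eqxx mulr1n big1 ?addr0// => i /negPf ->; rewrite mulr0n.
rewrite (bigD1 j)//= eqxx expr1 big1 => [|i /negPf ->]; last by rewrite expr0.
by rewrite mulr1 /r mulrCA divff ?mulr1.
Qed.

Lemma section_map_closed_image :
  opens (projective_space k n) (points (projective_space k n) `\` section_map @` points X).
Proof.
split=> [L []//|v v0 [_ nim]].
have nv : ~ exists sigma x,
    [/\ Sigma sigma, pt sigma x & <[v]>%VS = <[section_row sigma x]>%VS].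
  move=> [sigma [x [hs Tx vE]]]; apply: nim; exists (chart sigma x).
    exact: points_chart.
  by rewrite section_mapE.
have : ~ forall a b : 'I_n.+1 -> nat, (\sum_j a j = \sum_j b j)%N ->
     \sum_j e j *+ a j = \sum_j e j *+ b j ->
     \prod_j v ord0 j ^+ a j = \prod_j v ord0 j ^+ b j.
  by move=> /(section_map_closed_vector v0).
move=> /existsNP[a /existsNP[b /not_implyP[ab /not_implyP[eab vab]]]].
pose E := (\sum_j b j)%N.
have [i|p [hp pE]] := @homog_poly_sum k n.+1 E 2
  (fun i => if i == ord0 then 1 else -1) (fun i => if i == ord0 then a else b).
  by case: ifP.
have {}pE w : eval_row p w = \prod_j w ord0 j ^+ a j - \prod_j w ord0 j ^+ b j.
  by rewrite pE big_ord_recl big_ord1 /= mul1r mulN1r.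
exists E, p; split=> //; first by rewrite pE subr_eq0; apply/eqP.
move=> w w0 pw; split; first by rewrite /= dim_vline w0.
move=> [c /(points_full_chart hT hcomplete)[sigma [x [hs _ Tx ->]]]].
rewrite section_mapE// => /esym/(vline_eqP w0)[t t0 wE].
move: pw; rewrite wE (eval_rowZ _ _ hp) pE !section_row_monomial//.
have -> : \sum_j (e j - m sigma) *+ a j = \sum_j (e j - m sigma) *+ b j.
  under [LHS]eq_bigr do rewrite mulrnBl.
  under [RHS]eq_bigr do rewrite mulrnBl.
  by rewrite !sumrB eab !sumrMnr ab.
by rewrite subrr mulr0 eqxx.
Qed.

Lemma monomial_very_ample : very_ample k Sigma Gamma m.
Proof.
exists n, monomial_section, section_map; split.
- exact: monomial_basis.
- exact: exists_section_neq0.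
- exact: section_mapE.
split.
- exact: section_map_morphism.
- exact: section_map_inj.
- exact: section_map_closed_image.
- exact: section_map_embedding.
- exact: section_map_germs.
Qed.

End ConvexImpliesVeryAmple.

Theorem proposition8p7 (R : realType) (k : closedFieldType) (d : nat)
    (Sigma : set (set 'rV[R]_d)) (Gamma : set 'rV[R]_d -> set 'rV[int]_d)
    (h : 'rV[R]_d -> R) (m : set 'rV[R]_d -> 'rV[int]_d)
    (hT : toric_triple Sigma Gamma)
    (hcomplete : fan_support Sigma = setT)
    (hSF : support_function Sigma Gamma h m) :
  very_ample k Sigma Gamma m <->
  (strictly_upper_convex Sigma h m /\
   forall sigma, Sigma sigma -> cone_dim sigma d ->
     semigroup_gen [set u - m sigma | u in section_exponents Sigma Gamma m] =
     Gamma sigma).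
Proof.
split=> [hva|[hstrict hgen]]; first exact: (very_ample_convex hT hcomplete hSF hva).
have [n [e [e_inj eE]]] := enumerate_sections hT hcomplete hSF hgen.
exact: (monomial_very_ample k hT hcomplete hSF hstrict hgen e_inj eE).
Qed.
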